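(* Let $n\ge2$, $R>1$, $\sigma>0$, and let $\omega=(1,\alpha_1,\dots,\alpha_{n-1})=(1,\alpha)\in\mathbb{R}^n$ with $|\alpha_i|<1$ for $1\le i\le n-1$ be any non-resonant vector, i.e. $k\cdot\omega\ne0$ for all $k\in\mathbb{Z}^n\setminus\{0\}$. Let $l(I)=\omega\cdot I$, and let $\Delta=\Delta_\omega$ be the function associated with $\omega$ defined in the context. Then there exist a constant $c>0$ depending only on $R,\sigma$ and $\omega$, and a sequence $(f_j)_{j\ge1}$ of analytic functions on $V_\sigma(D)$ (real-valued on $D=\mathbb{T}^n\times B$), with $|f_j|_\sigma=\varepsilon_j\to0$ as $j\to+\infty$, such that for each $j$ the Hamiltonian system with Hamiltonian $H_j=l+f_j$ has orbits $(\theta(t),I(t))$, with initial conditions $(\theta_0,I_0)\in D$, which satisfy $$|I(t)-I_0|=|t|\,\varepsilon_j\exp\left(-2\sigma\,\Delta(c\,\varepsilon_j^{-1})\right)$$ for all times $t$ in the maximal interval on which the orbit is defined in $D$.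
   Context: $\mathbb{T}^n=\mathbb{R}^n/\mathbb{Z}^n$; $|\cdot|$ on vectors (real, complex or integer) is the supremum norm. $B=B_R\subset\mathbb{R}^n$ is an open ball of radius $R$ for the supremum norm and $D=\mathbb{T}^n\times B$. The complex neighbourhood is $V_\sigma(D)=\{(\theta,I)\in(\mathbb{C}^n/\mathbb{Z}^n)\times\mathbb{C}^n : |\mathrm{Im}\,\theta|<\sigma,\ d(I,B)<\sigma\}$, where $d$ is the distance associated with the supremum norm, and $|f|_\sigma=\sup_{z\in V_\sigma(D)}|f(z)|$. The Hamiltonian system of $H$ is $\dot\theta=\partial_I H$, $\dot I=-\partial_\theta H$. For $x\in\mathbb{R}$, $|x|_{\mathbb{Z}}=\min_{p\in\mathbb{Z}}|x-p|$. For $\omega=(1,\alpha)$ non-resonant, define for integers $K\ge 1$ $$\Psi(K)=\Psi_\omega(K)=\max\{|k\cdot\alpha|_{\mathbb{Z}}^{-1} : k\in\mathbb{Z}^{n-1},\ 0<|k|\le K\}.$$ Extend $\Psi$ to a continuous non-decreasing function on $[1,+\infty)$ (fixed once and for all, e.g. by linear interpolation between consecutive integers), still denoted $\Psi$. Set $\Lambda(x)=x\Psi(x)$ for $x\ge1$; it is continuous and strictly increasing, and $\Delta=\Lambda^{-1}$ denotes its inverse function, defined on $[\Lambda(1),+\infty)$. *)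

(* Defs.v *)
From HB Require Import structures.
From mathcomp Require Import all_boot all_order all_algebra.
From mathcomp Require Import all_classical all_reals all_analysis.
From mathcomp Require Import complex.

Set Implicit Arguments.
Unset Strict Implicit.
Unset Printing Implicit Defensive.

Import Order.TTheory GRing.Theory Num.Theory numFieldNormedType.Exports.

Local Open Scope classical_set_scope.
Local Open Scope ring_scope.
Local Open Scope complex_scope.

(* The library norm of a matrix is the supremum norm. Over R[i] its values are
   elements of R[i] (on the nonnegative real axis); cnorm reads them in R. *)
Definition cnorm (R : realType) (V : normedZmodType R[i]) (z : V) : R :=
  complex.Re `|z|.

Definition toC (R : realType) (n : nat) (x : 'rV[R]_n) : 'rV[R[i]]_n :=
  map_mx (fun a : R => a%:C) x.

Definition dot (R : pzRingType) (n : nat) (u v : 'rV[R]_n) : R :=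
  \sum_(i < n) u 0 i * v 0 i.

Definition omega (R : realType) (m : nat) (alpha : 'rV[R]_m) : 'rV[R]_m.+1 :=
  row_mx (const_mx 1 : 'rV[R]_1) alpha.

Definition nonresonant (R : realType) (n : nat) (w : 'rV[R]_n) : Prop :=
  forall k : 'rV[int]_n, k != 0 -> dot (map_mx intr k) w != 0.

(* The infimum is a minimum: the set is closed, nonempty and bounded below. *)
Definition distZ (R : realType) (x : R) : R :=
  inf [set `|x - p%:~R| | p in [set: int]].

Definition supnormZ (m : nat) (k : 'rV[int]_m) : nat :=
  (\max_(i < m) `|k 0%R i|)%N.

(* For m, K >= 1 the set is finite and nonempty, so the supremum is the
   maximum. *)
Definition Psi_int (R : realType) (m : nat) (alpha : 'rV[R]_m) (K : nat) : R :=
  sup [set (distZ (dot (map_mx intr k) alpha))^-1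
      | k in [set k : 'rV[int]_m | (0 < supnormZ k <= K)%N]].

(* Psi restricted to [1, +oo[ is one of the admissible extensions of Psi_int;
   its values outside [1, +oo[ are irrelevant. *)
Definition Psi_extension (R : realType) (m : nat) (alpha : 'rV[R]_m)
    (Psi : R -> R) : Prop :=
  [/\ forall K : nat, (1 <= K)%N -> Psi K%:R = Psi_int alpha K,
      {within `[1, +oo[, continuous Psi} &
      {in `[1, +oo[ &, {homo Psi : x y / x <= y}}].

Definition Lambda (R : realType) (Psi : R -> R) (x : R) : R := x * Psi x.

(* Meaningful on [Lambda Psi 1, +oo[ only; the default value 1 is returned
   below Lambda Psi 1. *)
Definition Delta (R : realType) (Psi : R -> R) : R -> R :=
  'pinv_(fun=> 1) `[1, +oo[ (Lambda Psi).

(* A point (theta, I) of C^n x C^n is the row vector row_mx theta I. Functions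
   on (C^n / Z^n) x C^n are represented by their Z^n-periodic lifts, and orbits
   in T^n x R^n by their lifts to R^n x R^n. The radius r of the real ball is
   for the supremum norm, its center b is arbitrary. *)
Definition distB (R : realType) (n : nat) (b : 'rV[R]_n) (r : R)
    (I : 'rV[R[i]]_n) : R :=
  inf [set cnorm (I - toC x) | x in ball b r].

Definition Vdom (R : realType) (n : nat) (b : 'rV[R]_n) (r sigma : R) :
    set 'rV[R[i]]_(n + n) :=
  [set z | `|map_mx (@complex.Im R) (lsubmx z)| < sigma /\
           distB b r (rsubmx z) < sigma].

Definition torus_periodic (R : realType) (n : nat) (U : set 'rV[R[i]]_(n + n))
    (f : 'rV[R[i]]_(n + n) -> R[i]) : Prop :=
  forall (z : 'rV[R[i]]_(n + n)) (k : 'rV[int]_n),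
    U z -> f (z + row_mx (map_mx intr k) 0) = f z.

Definition monomial (R : realType) (p : nat) (w : 'rV[R[i]]_p)
    (a : {ffun 'I_p -> nat}) : R[i] :=
  \prod_(i < p) w 0 i ^+ a i.

Definition box_index (p N : nat) (a : {ffun 'I_p -> 'I_N}) :
    {ffun 'I_p -> nat} :=
  [ffun i => (a i : nat)].

(* f is, on a polydisc of positive radius around z0, the sum of an absolutely
   convergent power series. Multi-indices are exhausted by the boxes [0, N[^p;
   under absolute convergence the order of summation does not matter. *)
Definition analytic_at (R : realType) (p : nat) (f : 'rV[R[i]]_p -> R[i])
    (z0 : 'rV[R[i]]_p) : Prop :=
  exists2 rho : R, 0 < rho &
  exists c : {ffun 'I_p -> nat} -> R[i],
  forall z : 'rV[R[i]]_p, cnorm (z - z0) < rho ->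
    (exists M : R, forall N : nat,
       \sum_(a : {ffun 'I_p -> 'I_N})
          cnorm (c (box_index a) * monomial (z - z0) (box_index a)) <= M) /\
    (fun N : nat => \sum_(a : {ffun 'I_p -> 'I_N})
          c (box_index a) * monomial (z - z0) (box_index a))
      @ \oo --> (f z : R[i]^o).

Definition analytic_on (R : realType) (p : nat) (U : set 'rV[R[i]]_p)
    (f : 'rV[R[i]]_p -> R[i]) : Prop :=
  forall z0, U z0 -> analytic_at f z0.

Definition real_on_D (R : realType) (n : nat) (b : 'rV[R]_n) (r : R)
    (f : 'rV[R[i]]_(n + n) -> R[i]) : Prop :=
  forall theta I : 'rV[R]_n, ball b r I ->
    complex.Im (f (row_mx (toC theta) (toC I))) = 0.

Definition sup_norm (R : realType) (n : nat) (b : 'rV[R]_n) (r sigma : R)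
    (f : 'rV[R[i]]_(n + n) -> R[i]) : \bar R :=
  ereal_sup [set (cnorm (f z : R[i]^o))%:E | z in Vdom b r sigma].

(* l + f on the real domain, where f is real-valued. *)
Definition perturbed (R : realType) (n : nat) (w : 'rV[R]_n)
    (f : 'rV[R[i]]_(n + n) -> R[i]) (theta I : 'rV[R]_n) : R :=
  dot w I + complex.Re (f (row_mx (toC theta) (toC I))).

Definition solves_hamiltonian (R : realType) (n : nat)
    (H : 'rV[R]_n -> 'rV[R]_n -> R) (J : set R) (theta I : R -> 'rV[R]_n) :
    Prop :=
  forall (t : R) (i : 'I_n), J t ->
    is_derive t 1 (fun s => theta s 0 i)
      ('D_(delta_mx 0 i) (H (theta t)) (I t)) /\
    is_derive t 1 (fun s => I s 0 i)
      (- 'D_(delta_mx 0 i) (H ^~ (I t)) (theta t)).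

Definition orbit_in_D (R : realType) (n : nat) (b : 'rV[R]_n) (r : R)
    (H : 'rV[R]_n -> 'rV[R]_n -> R) (J : set R) (theta I : R -> 'rV[R]_n) :
    Prop :=
  [/\ open J, is_interval J, J 0, forall t, J t -> ball b r (I t) &
      solves_hamiltonian H J theta I].

Definition maximal_orbit_in_D (R : realType) (n : nat) (b : 'rV[R]_n) (r : R)
    (H : 'rV[R]_n -> 'rV[R]_n -> R) (J : set R) (theta I : R -> 'rV[R]_n) :
    Prop :=
  orbit_in_D b r H J theta I /\
  forall (J' : set R) (theta' I' : R -> 'rV[R]_n),
    orbit_in_D b r H J' theta' I' -> theta' 0 = theta 0 -> I' 0 = I 0 ->
    J' `<=` J.

(* Main.v *)
Require Import Defs.
From HB Require Import structures.
From mathcomp Require Import all_boot all_order all_algebra.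
From mathcomp Require Import all_classical all_reals all_analysis.
From mathcomp Require Import complex.
From mathcomp Require Import zify ring lra.

Set Implicit Arguments.
Unset Strict Implicit.
Unset Printing Implicit Defensive.

Import Order.TTheory GRing.Theory Num.Theory numFieldNormedType.Exports.

Local Open Scope classical_set_scope.
Local Open Scope ring_scope.
Local Open Scope complex_scope.

(** Why the theorem is true.

    Let k in Z^(n-1) be a nonzero vector, q = |k|, p the integer nearest to
    k.alpha, L = k.alpha - p, and K = (-p, k), so that K.omega = L. Changing
    one coordinate of omega by delta = -L / k_i, where |k_i| = q, makes the
    frequency exactly resonant with K. This change is the linear term
    delta (I_i - b_i), whose size on the complex domain is at most
    |L| (r + sigma) / q. In the Hamiltonian
      omega.I + C + delta (I_i - b_i) + mu sin (2 pi K.theta)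
    the frequency is the constant omega' = omega + delta e_i. Along the orbit
    issued from theta = 0 the phase K.theta therefore remains 0, and the action
    moves on a straight line with speed 2 pi mu |K|: this orbit is explicit,
    and so is the time at which it leaves the ball (resonant_drift). The
    constant C has no dynamical effect and serves to adjust the supremum norm
    of the perturbation to a prescribed value eps (shift_to_sup_norm).

    What remains is to choose k and eps. The speed must be
    eps exp (- 2 sigma Delta (c / eps)), whereas a sine of frequency K has
    size about exp (2 pi sigma |K|_1) on the strip, |K|_1 being at most
    (2 n - 1) q. With eps = c / Lambda (A q) one gets Delta (c / eps) = A q
    exactly, and a fixed integer A > pi (2 n - 1) compensates the growth of
    the sine. The linear term is then at most eps / 2 as soon as
    |L| Psi (A q) <= M for a constant M, with c = 2 (r + sigma) A M. So one
    needs infinitely many integer vectors k that are, up to the factor M, the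
    best approximations not only among vectors of size |k| but even among
    those of size A |k|.

    That is quasi_best_approximations, and it holds for every nonresonant
    omega. Otherwise the minima e_i of |L| over vectors of size at most A^i X
    would decrease by a factor larger than M at each of t = 2 n - 1
    consecutive scales. Consider the combinations of the t corresponding
    minimal vectors with coefficients in [0, Q[. If M is large compared with
    Q, they are pairwise distinct, because a relation between numbers that
    decrease so fast must be trivial. But there are Q^t of them, more than
    there are cells of side X in the box which contains them: two of them
    differ by a vector of size at most X, on which the form is smaller than
    e_0, contradicting the minimality of e_0 (no_fast_decay). *)

(** * Integer vectors and distances to the integers *)

Lemma distZ_le (R : realType) (x : R) (p : int) : distZ x <= `|x - p%:~R|.
Proof.
apply: ge_inf; last by exists p.
by exists 0 => _ [q _ <-].
Qed.

Lemma distZ_attained (R : realType) (x : R) :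
  exists p : int, distZ x = `|x - p%:~R|.
Proof.
pose f := Num.floor x.
have [hf1 hf2] : f%:~R <= x /\ x < (f + 1)%:~R.
  by have /andP[] := floor_itv x.
rewrite intrD in hf2.
have min_attained (p : int) :
    (forall q : int, `|x - p%:~R| <= `|x - q%:~R|) -> distZ x = `|x - p%:~R|.
  move=> hp; apply/le_anti/andP; split; first exact: distZ_le.
  apply: lb_le_inf; first by exists `|x - p%:~R|; exists p.
  by move=> _ [q _ <-].
have far (q : int) : (x - f%:~R <= `|x - q%:~R|) \/
    ((f + 1)%:~R - x <= `|x - q%:~R|).
  have [qf|fq] := leP q f; [left|right].
    have : q%:~R <= f%:~R :> R by rewrite ler_int.
    by move=> h; apply: le_trans (ler_norm _); lra.
  have : (f + 1)%:~R <= q%:~R :> R by rewrite ler_int lezD1.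
  by move=> h; rewrite distrC; apply: le_trans (ler_norm _); lra.
have [h|h] := leP (x - f%:~R) ((f + 1)%:~R - x).
  exists f; apply: min_attained => q; rewrite ger0_norm; last by lra.
  by case: (far q) => //; apply: le_trans.
exists (f + 1); apply: min_attained => q.
rewrite distrC ger0_norm; last by rewrite intrD; lra.
by case: (far q) => //; apply: le_trans; apply: ltW.
Qed.

Lemma distZ_le1 (R : realType) (x : R) : distZ x <= 1.
Proof.
apply: le_trans (distZ_le x (Num.floor x)) _.
have /andP[h1 h2] := floor_itv x; rewrite intrD in h2.
by rewrite ger0_norm; lra.
Qed.

Lemma supnormZ_leP (m : nat) (k : 'rV[int]_m) (K : nat) :
  reflect (forall i, (`|k 0%R i| <= K)%N) (supnormZ k <= K)%N.
Proof.
by apply: (iffP (bigmax_leqP _ _ _)) => h i => [|_]; apply: h.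
Qed.

Lemma supnormZ_gt0 (m : nat) (k : 'rV[int]_m) : (0 < supnormZ k)%N = (k != 0).
Proof.
rewrite lt0n; congr negb; apply/eqP/eqP => [k0|->].
  apply/rowP => i; rewrite mxE; apply/eqP; rewrite -absz_eq0 -leqn0.
  by have /supnormZ_leP := eq_leq k0; apply.
by apply/eqP; rewrite -leqn0; apply/supnormZ_leP => i; rewrite mxE.
Qed.

Lemma supnormZ_attained (m : nat) (k : 'rV[int]_m) : (0 < m)%N ->
  exists i, supnormZ k = `|k 0%R i|%N.
Proof.
move=> m0; have [|i hi] := @bigop.eq_bigmax _ (fun i => `|k 0%R i|%N).
  by rewrite card_ord.
by exists i.
Qed.

Lemma dotZl (R : pzRingType) (n : nat) (a : R) (u w : 'rV[R]_n) :
  dot (a *: u) w = a * dot u w.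
Proof. by rewrite /dot mulr_sumr; apply: eq_bigr => i _; rewrite mxE mulrA. Qed.

Lemma dot_suml (R : pzRingType) (n t : nat) (u : 'I_t -> 'rV[R]_n) w :
  dot (\sum_(i < t) u i) w = \sum_(i < t) dot (u i) w.
Proof.
rewrite /dot exchange_big; apply: eq_bigr => i _.
by rewrite summxE mulr_suml.
Qed.

Lemma dot_row_mx (R : pzRingType) (n1 n2 : nat) (u1 v1 : 'rV[R]_n1)
    (u2 v2 : 'rV[R]_n2) :
  dot (row_mx u1 u2) (row_mx v1 v2) = dot u1 v1 + dot u2 v2.
Proof.
by rewrite /dot big_split_ord; congr (_ + _); apply: eq_bigr => i _;
  rewrite ?row_mxEl ?row_mxEr.
Qed.

Lemma dot_omega (R : realType) (m : nat) (alpha : 'rV[R]_m) (k : 'rV[int]_m)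
    (p : int) :
  dot (map_mx intr (row_mx (const_mx (- p) : 'rV_1) k)) (omega alpha) =
  dot (map_mx intr k) alpha - p%:~R.
Proof.
rewrite map_row_mx dot_row_mx addrC; congr (_ + _).
by rewrite /dot big_ord1 !mxE mulr1 mulrNz.
Qed.

Lemma nonresonant_form_neq0 (R : realType) (m : nat) (alpha : 'rV[R]_m)
    (k : 'rV[int]_m) (p : int) : nonresonant (omega alpha) ->
  k != 0 -> dot (map_mx intr k) alpha - p%:~R != 0.
Proof.
move=> hres k0; rewrite -dot_omega; apply: hres; apply: contra k0 => /eqP h.
have := congr1 (fun M : 'rV_(1 + m) => rsubmx M) h.
by rewrite row_mxKr => ->; apply/eqP/rowP => i; rewrite !mxE.
Qed.

Lemma best_approximation (R : realType) (m K : nat) (alpha : 'rV[R]_m) :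
  (0 < m)%N -> (0 < K)%N ->
  exists2 k : 'rV[int]_m, (0 < supnormZ k <= K)%N &
  forall d : 'rV[int]_m, (0 < supnormZ d <= K)%N ->
    distZ (dot (map_mx intr k) alpha) <= distZ (dot (map_mx intr d) alpha).
Proof.
move=> m0 K0.
pose dec (a : {ffun 'I_m -> 'I_(2 * K).+1}) : 'rV[int]_m :=
  \row_i ((a i : nat)%:Z - K%:Z).
pose P a := (0 < supnormZ (dec a) <= K)%N.
have dec_onto (d : 'rV[int]_m) : (supnormZ d <= K)%N -> exists a, dec a = d.
  move/supnormZ_leP => h.
  exists [ffun i => inord `|(d 0 i + K%:Z)%R|%N]; apply/rowP => i.
  by rewrite mxE ffunE inordK; have := h i; lia.
have P1 : exists a, P a.
  have [|a ha] := dec_onto (const_mx 1).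
    by apply/supnormZ_leP => i; rewrite mxE.
  exists a; rewrite /P ha supnormZ_gt0; apply/andP; split.
    by apply/eqP => /rowP /(_ (Ordinal m0)); rewrite !mxE.
  by apply/supnormZ_leP => i; rewrite mxE.
case: P1 => a0 Pa0.
pose F a := distZ (dot (map_mx intr (dec a)) alpha).
case: (Order.TotalTheory.arg_minP F Pa0) => a Pa amin.
exists (dec a) => // d hd; have [] := dec_onto d; first by case/andP: hd.
by move=> a' ha'; rewrite -ha'; apply: amin; rewrite /P ha'.
Qed.

(** * Quasi-best approximations *)

(** The pigeonhole argument described at the top. The exponent t > 2 m comes
    from the count of cells: a cell is given by m coordinates, each with at
    most 2 t Q A^t + 1 <= Q^2 values, against Q^t combinations. *)
Lemma no_fast_decay (R : realType) (m : nat) (alpha : 'rV[R]_m)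
    (X A Q t : nat) (k : nat -> 'rV[int]_m) (p : nat -> int)
    (L := fun i => dot (map_mx intr (k i)) alpha - (p i)%:~R) :
  (0 < X)%N -> (2 * m < t)%N -> (2 * t * A ^ t < Q)%N -> (0 < A)%N ->
  (forall i, (i <= t)%N -> (supnormZ (k i) <= A ^ i * X)%N) ->
  (forall d : 'rV[int]_m, (0 < supnormZ d <= X)%N ->
    `|L 0%N| <= distZ (dot (map_mx intr d) alpha)) ->
  (forall i, (i <= t)%N -> L i != 0) -> `|L 0%N| <= 1 ->
  (forall i, (i < t)%N -> `|L i.+1| * (t * Q)%:R < `|L i|) -> False.
Proof.
move=> X0 mt hQ A0 hk h0 Lneq0 L1 hdec.
have tQ0 : (0 < t * Q)%N by nia.
have Ldec j i : (i < j)%N -> (j <= t)%N -> `|L j| * (t * Q)%:R < `|L i|.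
  elim: j => // j IH; rewrite ltnS leq_eqVlt => /orP[/eqP ->|ij] jt.
    exact: hdec.
  apply: lt_trans (hdec _ jt) _; apply: le_lt_trans (IH ij (ltnW jt)).
  by rewrite ler_peMr // ler1n.
pose c (a a' : {ffun 'I_t -> 'I_Q}) i : int := (a i : nat)%:Z - (a' i : nat)%:Z.
pose S (a : {ffun 'I_t -> 'I_Q}) : 'rV[int]_m :=
  \sum_(i < t) (a i : nat)%:Z *: k i.+1.
have cQ a a' i : `|(c a a' i)%:~R| <= Q%:R :> R.
  have -> : (Q%:R : R) = (Q%:Z)%:~R by [].
  rewrite -intr_norm ler_int /c; have := ltn_ord (a i); have := ltn_ord (a' i).
  lia.
(* A vanishing combination of the L i with coefficients below Q is trivial:
   the first nonzero term would dominate all the later ones. *)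
have indep a a' : \sum_(i < t) (c a a' i)%:~R * L i.+1 = 0 -> a = a'.
  move=> hs; apply/ffunP => i; apply/val_inj.
  suff : c a a' i = 0 by rewrite /c => /eqP; rewrite subr_eq0 => /eqP [].
  have [n] := ubnP (i : nat); elim: n i => // n IH i /ltnSE hi.
  apply/eqP; apply: contraT => ci.
  have Li : 0 < `|L i.+1| by rewrite normr_gt0 Lneq0.
  (* At the first nonzero coefficient, each of the at most t - 1 later terms has
     absolute value at most |L i.+1| / t. *)
  suff : `|L i.+1| * t%:R < `|L i.+1| * t%:R by rewrite ltxx.
  have ci1 : 1 <= `|(c a a' i)%:~R| :> R.
    by rewrite -intr_norm (ler_int _ 1); move: ci; lia.
  have t0 : (0 < t)%N by lia.
  apply: (@le_lt_trans _ _ (`|L i.+1| * t.-1%:R)); last first.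
    by rewrite ltr_pM2l // ltr_nat; lia.
  apply: (@le_trans _ _ (`|(c a a' i)%:~R * L i.+1| * t%:R)).
    by rewrite ler_wpM2r // normrM ler_peMl.
  move: hs; rewrite (bigD1 i) //= => /eqP; rewrite addr_eq0 => /eqP ->.
  rewrite normrN; apply: le_trans (ler_wpM2r _ (ler_norm_sum _ _ _)) _ => //.
  rewrite mulr_suml.
  apply: (@le_trans _ _ (\sum_(j < t | j != i) `|L i.+1|)).
    apply: ler_sum => j ji.
    have [ij|ij] := leqP j i.
      rewrite IH ?mul0r ?normr0 ?mul0r //; apply: leq_trans hi.
      by rewrite ltn_neqAle ij andbT.
    apply: le_trans (ltW (Ldec j.+1 i.+1 ij (ltn_ord j))).
    rewrite normrM natrM [t%:R * _]mulrC mulrA ler_wpM2r // mulrC.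
    by rewrite ler_wpM2l.
  have := cardC1 i; rewrite card_ord => card_t1.
  by rewrite sumr_const mulr_natr -card_t1 lexx.
pose B : nat := (t * Q * A ^ t * X)%N.
pose N : nat := (2 * t * Q * A ^ t)%N.
have SB a l : (`|S a 0%R l| <= B)%N.
  suff : `|S a 0%R l| <= B%:Z by lia.
  rewrite summxE; apply: le_trans (ler_norm_sum _ _ _) _.
  apply: (@le_trans _ _ (\sum_(i < t) (Q * A ^ t * X)%N%:Z)).
    apply: ler_sum => i _; rewrite mxE -abszE abszM lez_nat.
    have /supnormZ_leP /(_ l) hh := hk i.+1 (ltn_ord i).
    have hA : (A ^ i.+1 <= A ^ t)%N by rewrite leq_pexp2l.
    have h2 := ltn_ord (a i).
    rewrite -mulnA; apply: leq_mul (ltnW h2) _; apply: leq_trans hh _.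
    by rewrite leq_mul2r hA orbT.
  rewrite sumr_const card_ord /B; lia.
(* The cell of side X containing S a; the shift by B makes the coordinates
   nonnegative. *)
pose cell (a : {ffun 'I_t -> 'I_Q}) : {ffun 'I_m -> 'I_N.+1} :=
  [ffun l => inord (`|(S a 0 l + B%:Z)%R| %/ X)].
suff cell_inj : injective cell.
  have := leq_card _ cell_inj.
  rewrite !card_ffun !card_ord leqNgt => /negP; apply.
  have NQ : (N.+1 <= Q ^ 2)%N by rewrite /N; nia.
  apply: (@leq_ltn_trans ((Q ^ 2) ^ m)).
    by case: (m) => // n; rewrite leq_exp2r.
  by rewrite -expnM ltn_exp2l //; nia.
move=> a a' haa'; apply: indep.
pose d := S a - S a'.
have dX : (supnormZ d <= X)%N.
  apply/supnormZ_leP => l.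
  have := congr1 (fun f : {ffun 'I_m -> 'I_N.+1} => nat_of_ord (f l)) haa'.
  have Sa := SB a l; have Sa' := SB a' l.
  have cellb n : (n <= 2 * B)%N -> (n %/ X < N.+1)%N.
    move=> hn; rewrite ltnS; apply: leq_trans (leq_div2r _ hn) _.
    by rewrite /B /N !mulnA mulnK.
  rewrite !ffunE !inordK; try by apply: cellb; lia.
  rewrite !mxE.
  have := divn_eq `|(S a 0 l + B%:Z)%R| X.
  have := divn_eq `|(S a' 0 l + B%:Z)%R| X.
  have := ltn_pmod `|(S a 0 l + B%:Z)%R| X0.
  have := ltn_pmod `|(S a' 0 l + B%:Z)%R| X0.
  move: (S a 0 l) (S a' 0 l) Sa Sa' => x y Sa Sa'.
  move: (`|_| %% _)%N (`|_| %% _)%N => r1 r2 hr1 hr2 hu hv hq.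
  rewrite hq in hv; move: (_ %/ _ * _)%N hu hv => w hu hv; lia.
pose P : int := \sum_(i < t) c a a' i * p i.+1.
have dE : dot (map_mx intr d) alpha - P%:~R =
    \sum_(i < t) (c a a' i)%:~R * L i.+1.
  have -> : d = \sum_(i < t) c a a' i *: k i.+1.
    by rewrite /d -sumrB; apply: eq_bigr => i _; rewrite scalerBl.
  rewrite raddf_sum dot_suml /P raddf_sum -sumrB; apply: eq_bigr => i _.
  by rewrite /L mulrBr /= intrM map_mxZ dotZl.
(* Two combinations in the same cell: the form on their difference d is below
   the minimum over vectors of size at most X, so that d = 0. *)
have small : `|dot (map_mx intr d) alpha - P%:~R| < `|L 0%N|.
  rewrite dE; apply: le_lt_trans (ler_norm_sum _ _ _) _.
  have t0 : (0 < t)%N by lia.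
  apply: le_lt_trans (Ldec 1 0 _ _)%N => //.
  apply: (@le_trans _ _ (\sum_(i < t) `|L 1%N| * Q%:R)).
    apply: ler_sum => i _; rewrite normrM mulrC; apply: ler_pM => //.
    case: (i : nat) (ltn_ord i) => // n hn.
    apply: le_trans (ltW (Ldec n.+2 1%N _ _)) => //.
    by rewrite ler_peMr // ler1n.
  by rewrite sumr_const card_ord -mulrnAr -[Q%:R *+ t]mulr_natl natrM.
have d0 : d = 0.
  apply/eqP; apply: contraT; rewrite -supnormZ_gt0 => dgt0.
  have := h0 d; rewrite dgt0 dX => /(_ isT) hL.
  have := le_lt_trans (le_trans hL (distZ_le _ P)) small.
  by rewrite ltxx.
(* Since d = 0, the form takes on it the integer value - P, of absolute value
   below 1. *)
rewrite -dE d0; move: small; rewrite d0 map_mx0.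
have -> : dot 0 alpha = 0 :> R.
  by rewrite /dot big1 // => i _; rewrite mxE mul0r.
rewrite sub0r normrN => /lt_le_trans /(_ L1).
rewrite -intr_norm (ltr_int _ _ 1) => hP.
have P0 : P = 0 by move: hP; clearbody P => hP; lia.
by rewrite P0 mulr0z oppr0.
Qed.

(** Dirichlet's pigeonhole principle applied to the multiples of a single
    coordinate of alpha: this makes the perturbations as small as wanted. *)
Lemma distZ_arbitrarily_small (R : realType) (m : nat) (alpha : 'rV[R]_m)
    (eta : R) : (0 < m)%N -> 0 < eta ->
  exists2 d : 'rV[int]_m, d != 0 & distZ (dot (map_mx intr d) alpha) < eta.
Proof.
move=> m0 eta0; pose i0 := Ordinal m0; pose x := alpha 0 i0.
pose N := Num.bound eta^-1.
have Neta : eta^-1 < N%:R.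
  by have := archi_boundP (ltW (etrans (invr_gt0 _) eta0)).
have N0 : (0 < N)%N by rewrite -(ltr_nat R) (lt_trans _ Neta) // invr_gt0.
have N0r : 0 < N%:R :> R by rewrite ltr0n.
pose fl (a : 'I_N.+1) := Num.floor (a%:R * x).
pose fr (a : 'I_N.+1) : R := a%:R * x - (fl a)%:~R.
have fr01 a : 0 <= fr a < 1.
  have /andP[h1 h2] := floor_itv (a%:R * x).
  by rewrite /fr subr_ge0 h1 ltrBlDl; move: h2; rewrite intrD.
pose cell (a : 'I_N.+1) : int := Num.floor (N%:R * fr a).
have cellP a : (cell a)%:~R <= N%:R * fr a < (cell a)%:~R + 1.
  by have := floor_itv (N%:R * fr a); rewrite intrD.
have cell_lt a : 0 <= cell a < N%:Z.
  have /andP[f0 f1] := fr01 a; have /andP[h1 h2] := cellP a.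
  apply/andP; split.
    rewrite -[X in X <= _]add0r -ltzD1 -(ltr_int R) intrD.
    by apply: le_lt_trans h2; rewrite mulr_ge0 // ltW.
  rewrite -(ltr_int R); apply: le_lt_trans h1 _.
  by rewrite -[X in _ < X]mulr1 ltr_pM2l.
have : ~ injective (fun a => inord `|cell a|%N : 'I_N.-1.+1).
  by move=> /leq_card; rewrite !card_ord prednK // ltnn.
move=> /injectiveP /injectivePn [a [a' aa' haa']].
have {}haa' : cell a = cell a'.
  have := congr1 (fun u : 'I_N.-1.+1 => nat_of_ord u) haa'.
  have ha := cell_lt a; have ha' := cell_lt a'.
  by rewrite !inordK; lia.
exists (((a : nat)%:Z - (a' : nat)%:Z) *: delta_mx 0 i0).
  apply/eqP => /rowP /(_ i0); rewrite !mxE !eqxx mulr1 => /eqP.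
  by rewrite subr_eq0 => /eqP [] /val_inj /eqP; rewrite (negPf aa').
apply: le_lt_trans (distZ_le _ (fl a - fl a')) _.
rewrite map_mxZ dotZl /dot (bigD1 i0) //= big1 => [|i ii0]; last first.
  by rewrite !mxE (negPf ii0) andbF mul0r.
rewrite !mxE !eqxx mul1r addr0 -/x.
have -> : ((a : nat)%:Z - (a' : nat)%:Z)%:~R * x - (fl a - fl a')%:~R =
    fr a - fr a'.
  by rewrite /fr !intrB; ring.
have /andP[h1 h2] := cellP a; have /andP[] := cellP a'; rewrite -haa' => h3 h4.
have hN : `|N%:R * (fr a - fr a')| < 1 by rewrite ltr_norml; lra.
rewrite normrM gtr0_norm // in hN.
rewrite -(ltr_pM2l N0r); apply: lt_trans hN _.
by rewrite -[ltLHS](mulVf (lt0r_neq0 eta0)) ltr_pM2r.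
Qed.

(** Some scale between X and A^t X provides the vector k, where X is the size
    of a vector on which the form is below eta; the form is then below eta
    on k as well. *)
Lemma quasi_best_approximations (R : realType) (m A : nat)
    (alpha : 'rV[R]_m) : (0 < m)%N -> (0 < A)%N -> nonresonant (omega alpha) ->
  exists2 M : R, 0 < M &
  forall eta : R, 0 < eta ->
  exists (k : 'rV[int]_m) (p : int),
    let L := dot (map_mx intr k) alpha - p%:~R in
    [/\ k != 0, `|L| < eta &
        forall d : 'rV[int]_m, (0 < supnormZ d <= A * supnormZ k)%N ->
          `|L| <= M * distZ (dot (map_mx intr d) alpha)].
Proof.
move=> m0 A0 hres; pose t := (2 * m).+1; pose Q := (2 * t * A ^ t).+1.
exists (t * Q)%:R => [|eta eta0]; first by rewrite ltr0n.
have [d0 d0neq0 d0eta] := distZ_arbitrarily_small alpha m0 eta0.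
pose X := supnormZ d0; have X0 : (0 < X)%N by rewrite supnormZ_gt0.
have AX0 i : (0 < A ^ i * X)%N by rewrite muln_gt0 expn_gt0 A0.
have /choice [kp hkp] i : exists kp : 'rV[int]_m * int,
    [/\ (0 < supnormZ kp.1 <= A ^ i * X)%N,
      forall d : 'rV[int]_m, (0 < supnormZ d <= A ^ i * X)%N ->
        distZ (dot (map_mx intr kp.1) alpha) <=
        distZ (dot (map_mx intr d) alpha) &
      distZ (dot (map_mx intr kp.1) alpha) =
        `|dot (map_mx intr kp.1) alpha - kp.2%:~R|].
  have [k hk kbest] := best_approximation alpha m0 (AX0 i).
  have [p hp] := distZ_attained (dot (map_mx intr k) alpha).
  by exists (k, p).
pose k i := (kp i).1; pose p i := (kp i).2.
pose L i := dot (map_mx intr (k i)) alpha - (p i)%:~R.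
have LE i : distZ (dot (map_mx intr (k i)) alpha) = `|L i| by have [] := hkp i.
have kle i : (supnormZ (k i) <= A ^ i * X)%N.
  by have [/andP[]] := hkp i.
have kneq0 i : k i != 0 by rewrite -supnormZ_gt0; have [/andP[]] := hkp i.
have kbest i d : (0 < supnormZ d <= A ^ i * X)%N ->
    `|L i| <= distZ (dot (map_mx intr d) alpha).
  by rewrite -LE; have [_ + _] := hkp i; apply.
have [i it hi] : exists2 i, (i < t)%N & `|L i| <= `|L i.+1| * (t * Q)%:R.
  apply: contrapT => hno.
  apply: (@no_fast_decay R m alpha X A Q t k p) => //.
  - by move=> d; have := @kbest 0 d; rewrite expn0 mul1n.
  - by move=> i _; apply: nonresonant_form_neq0.
  - by rewrite -LE distZ_le1.
  - by move=> i it; rewrite ltNge; apply/negP => h; apply: hno; exists i.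
exists (k i), (p i); split => //.
  apply: le_lt_trans d0eta; apply: kbest.
  by rewrite X0 leq_pmull // expn_gt0 A0.
move=> d /andP[d1 d2]; apply: le_trans hi _; rewrite mulrC ler_wpM2l //.
apply: kbest; rewrite d1 (leq_trans d2) // expnS -mulnA leq_mul2l kle orbT //.
Qed.

(** * The complex exponential and sine *)

Definition exp_sum (F : numFieldType) (N : nat) (z : F) : F :=
  \sum_(n < N) z ^+ n / n`!%:R.

(** The terms with i + j < N of the product of two partial sums make up the
    partial sum of z + w by the binomial formula. *)
Lemma exp_sumM_sub (F : numFieldType) (N : nat) (z w : F) :
  exp_sum N z * exp_sum N w - exp_sum N (z + w) =
  \sum_(i < N) \sum_(j < N | (N <= i + j)%N)
     z ^+ i / i`!%:R * (w ^+ j / j`!%:R).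
Proof.
pose T i j := z ^+ i / i`!%:R * (w ^+ j / j`!%:R).
have -> : exp_sum N (z + w) = \sum_(i < N) \sum_(j < N | (i + j < N)%N) T i j.
  transitivity (\sum_(n < N) \sum_(i < N | (i <= n)%N) T i (n - i)%N).
    apply: eq_bigr => n _; rewrite addrC exprDn mulr_suml.
    rewrite (big_ord_widen_cond N xpredT (fun i => (w ^+ (n - i) * z ^+ i *+
      'C(n, i)) / n`!%:R)) //; apply: eq_big => // i.
    rewrite /= ltnS => in_.
    have fn0 k : k`!%:R != 0 :> F by rewrite pnatr_eq0 -lt0n fact_gt0.
    rewrite /T -(bin_fact in_) !natrM -mulr_natr.
    have bn0 : 'C(n, i)%:R != 0 :> F by rewrite pnatr_eq0 -lt0n bin_gt0.
    by field; rewrite bn0 !fn0.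
  rewrite (exchange_big_dep xpredT) //=; apply: eq_bigr => i _.
  rewrite -(big_mkord (fun n => (i <= n)%N) (fun n => T i (n - i)%N)).
  rewrite -(big_mkord (fun j => (i + j < N)%N) (fun j => T i j)).
  rewrite (@big_cat_nat _ _ _ i) ?leq0n ?(ltnW (ltn_ord i)) //=.
  rewrite big_nat_cond big_pred0 ?add0r; last by move=> n; lia.
  rewrite -{1}[nat_of_ord i]add0n big_addn.
  rewrite (@big_cat_nat _ _ _ (N - i) 0 N) ?leq0n ?leq_subr //=.
  rewrite [X in _ = _ + X]big_nat_cond [X in _ = _ + X]big_pred0 ?addr0.
    rewrite big_nat_cond [RHS]big_nat_cond; apply: eq_big => [j|j _].
      by lia.
    by rewrite addnK.
  by move=> j; lia.
rewrite /exp_sum big_distrlr -sumrB; apply: eq_bigr => i _.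
rewrite (bigID (fun j : 'I_N => (N <= i + j)%N)) /=.
rewrite [X in _ + X - _](eq_bigl (fun j : 'I_N => (i + j < N)%N)) ?addrK //.
by move=> j; rewrite ltnNge.
Qed.

(** The defect of multiplicativity has nonnegative coefficients, hence is
    dominated by the same defect at the norms, and this one tends to 0 by the
    functional equation of the real exponential. *)
Lemma norm_exp_sumM_sub (F : numFieldType) (N : nat) (z w : F) :
  `|exp_sum N z * exp_sum N w - exp_sum N (z + w)| <=
  exp_sum N `|z| * exp_sum N `|w| - exp_sum N (`|z| + `|w|).
Proof.
rewrite !exp_sumM_sub; apply: le_trans (ler_norm_sum _ _ _) _.
apply: ler_sum => i _; apply: le_trans (ler_norm_sum _ _ _) _.
by apply: ler_sum => j _; rewrite !normrM !normfV !normrX !normr_nat.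
Qed.

Lemma exp_sum_cvg (R : realType) (x : R) :
  exp_sum N x @[N --> \oo] --> expR x.
Proof.
have -> : (fun N => exp_sum N x) = series (exp_coeff x).
  by apply/funext => N; rewrite /series /= big_mkord.
exact: is_cvg_series_exp_coeff.
Qed.

Lemma exp_sum_le (R : realType) (N : nat) (x : R) : 0 <= x ->
  exp_sum N x <= expR x.
Proof.
move=> x0; have -> : exp_sum N x = series (exp_coeff x) N.
  by rewrite /series /= big_mkord.
apply: nondecreasing_cvgn_le; last exact: is_cvg_series_exp_coeff.
apply/nondecreasing_seqP => n; rewrite seriesSr lerDl.
exact: exp_coeff_ge0.
Qed.

Lemma cnormE (R : realType) (V : normedZmodType R[i]) (z : V) :
  (cnorm z)%:C = `|z|.
Proof. exact/RRe_real/normr_real. Qed.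

Lemma cnorm_ge0 (R : realType) (V : normedZmodType R[i]) (z : V) :
  0 <= cnorm z.
Proof. by rewrite -lecR cnormE rmorph0. Qed.

Lemma cnormM (R : realType) (z w : R[i]) : cnorm (z * w) = cnorm z * cnorm w.
Proof. by apply: complexI; rewrite rmorphM /= !cnormE normrM. Qed.

Lemma cnormD_le (R : realType) (V : normedZmodType R[i]) (z w : V) :
  cnorm (z + w) <= cnorm z + cnorm w.
Proof. by rewrite -lecR rmorphD /= !cnormE ler_normD. Qed.

Lemma cnormR (R : realType) (x : R) : cnorm (x%:C : R[i]) = `|x|.
Proof.
apply: complexI; rewrite cnormE normc_def /= expr0n addr0 sqrtr_sqr //.
Qed.

Lemma cnorm_le_ReIm (R : realType) (z : R[i]) :
  cnorm z <= `|complex.Re z| + `|complex.Im z|.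
Proof.
rewrite {1}[z]complexE; apply: le_trans (cnormD_le _ _) _.
rewrite cnormM !cnormR (_ : cnorm 'i = 1) ?mul1r //.
by apply: complexI; rewrite cnormE normc_def /= expr0n add0r expr1n sqrtr1.
Qed.

Lemma cvgC_squeeze (R : realType) (u : nat -> R[i]) (l : R[i]) (b : nat -> R) :
  (forall n, cnorm (u n - l) <= b n) -> b @ \oo --> (0 : R) ->
  u @ \oo --> (l : R[i]^o).
Proof.
move=> hb b0; apply/(@cvgrPdist_lt R[i] (R[i]^o)) => eps eps0.
have /andP[/eqP eim ere] : (complex.Im eps == 0) && (0 < complex.Re eps).
  by move: eps0; rewrite ltcE.
have epsE : eps = (complex.Re eps)%:C.
  by apply/eqP; rewrite eq_complex eim !eqxx.
have /cvgrPdist_lt /(_ _ ere) := b0; apply: filterS => n.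
rewrite sub0r normrN => hn; rewrite distrC -[`|_|]cnormE epsE ltcR.
exact: le_lt_trans (hb n) (le_lt_trans (ler_norm _) hn).
Qed.

Lemma cvgC_ReIm (R : realType) (u : nat -> R[i]) (l : R[i]) :
  complex.Re (u n) @[n --> \oo] --> complex.Re l ->
  complex.Im (u n) @[n --> \oo] --> complex.Im l ->
  u @ \oo --> (l : R[i]^o).
Proof.
move=> hre him; apply: (@cvgC_squeeze _ _ _ (fun n =>
  `|complex.Re (u n) - complex.Re l| + `|complex.Im (u n) - complex.Im l|)).
  move=> n; apply: le_trans (cnorm_le_ReIm _) _.
  by case: (u n) l {hre him} => [a b] [c d].
have dist_cvg0 (v : nat -> R) (a : R) : v @ \oo --> a ->
    `|v n - a| @[n --> \oo] --> (0 : R).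
  move=> /cvgrPdist_lt va; apply/cvgrPdist_lt => e /va; apply: filterS => n.
  by rewrite sub0r normrN normr_id distrC.
by rewrite -[0 in X in _ --> X]addr0; apply: cvgD; apply: dist_cvg0.
Qed.

(** Defined by Euler's formula, so that its modulus, its functional equation
    and its values on the real axis follow from the real functions; the power
    series is recovered in exp_sum_cvg_cexp. *)
Definition cexp (R : realType) (z : R[i]) : R[i] :=
  (expR (complex.Re z))%:C * (cos (complex.Im z) +i* sin (complex.Im z)).

Lemma cexpD (R : realType) (z w : R[i]) : cexp (z + w) = cexp z * cexp w.
Proof.
case: z w => [a b] [c d]; rewrite /cexp /= expRD cosD sinD.
by apply/eqP; rewrite eq_complex /=; apply/andP; split; apply/eqP; ring.
Qed.

Lemma cexp_sum (R : realType) (p : nat) (z : 'I_p -> R[i]) :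
  cexp (\sum_(l < p) z l) = \prod_(l < p) cexp (z l).
Proof.
apply: (big_morph (@cexp R)) => [z1 z2|]; first exact: cexpD.
by rewrite /cexp /= expR0 cos0 sin0 mul1r.
Qed.

Lemma cnorm_cexp (R : realType) (z : R[i]) :
  cnorm (cexp z) = expR (complex.Re z).
Proof.
rewrite cnormM cnormR ger0_norm ?expR_ge0 // -[RHS]mulr1; congr (_ * _).
by apply: complexI; rewrite cnormE normc_def /= cos2Dsin2 sqrtr1.
Qed.

Lemma exp_sum_real (R : realType) (N : nat) (x : R) :
  exp_sum N (x%:C : R[i]) = (exp_sum N x)%:C.
Proof.
rewrite /exp_sum raddf_sum; apply: eq_bigr => n _ /=.
by rewrite rmorphM fmorphV rmorphXn /= rmorph_nat.
Qed.

Lemma exp_term_imaginary (R : realType) (n : nat) (y : R) :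
  (0 +i* y) ^+ n / n`!%:R = cos_coeff y n +i* sin_coeff y n :> R[i].
Proof.
have -> : n`!%:R = (n`!%:R : R)%:C by rewrite rmorph_nat.
have pow_even k : (0 +i* y : R[i]) ^+ k.*2 = ((-1) ^+ k * y ^+ k.*2)%:C.
  have sq : (0 +i* y : R[i]) ^+ 2 = (- y ^+ 2)%:C.
    by apply/eqP; rewrite expr2 eq_complex /=; apply/andP; split; apply/eqP;
      ring.
  by rewrite -muln2 mulnC !exprM sq -rmorphXn /= [(- y ^+ 2) ^+ k]exprNn.
rewrite -fmorphV /cos_coeff /sin_coeff /= -!exprnP.
move: (n`!%:R^-1) => c.
rewrite -[X in _ ^+ X](odd_double_half n) exprD pow_even.
have -> : n.-1./2 = if odd n then n./2 else n.-1./2.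
  by case: ifP => // on; rewrite -{1}(odd_double_half n) on /= doubleK.
have -> : y ^+ n = y ^+ odd n * y ^+ n./2.*2.
  by rewrite -exprD odd_double_half.
case: (odd n); rewrite ?expr1 ?expr0;
  by apply/eqP; rewrite eq_complex /=; apply/andP; split; apply/eqP; ring.
Qed.

Lemma exp_sum_imaginary (R : realType) (N : nat) (y : R) :
  exp_sum N (0 +i* y) =
  series (cos_coeff y) N +i* series (sin_coeff y) N :> R[i].
Proof.
rewrite /exp_sum /series /= !big_mkord; elim: N => [|N IH].
  by rewrite !big_ord0.
by rewrite !big_ord_recr /= IH exp_term_imaginary.
Qed.

(** On the two axes the series is the real exponential series, or the cosine
    and sine series; the general case is their product, up to the defect
    estimated in norm_exp_sumM_sub. *)
Lemma exp_sum_cvg_cexp (R : realType) (z : R[i]) :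
  exp_sum N z @[N --> \oo] --> (cexp z : R[i]^o).
Proof.
case: z => x y; have -> : x +i* y = x%:C + (0 +i* y) :> R[i].
  by apply/eqP; rewrite eq_complex /= addr0 add0r !eqxx.
have hx : exp_sum N (x%:C : R[i]) @[N --> \oo] --> (cexp x%:C : R[i]^o).
  rewrite /cexp /= cos0 sin0 mulr1.
  apply: cvgC_ReIm => /=; under eq_fun do rewrite exp_sum_real.
    exact: exp_sum_cvg.
  exact: cvg_cst.
have hy : exp_sum N (0 +i* y : R[i]) @[N --> \oo] --> (cexp (0 +i* y) : R[i]^o).
  rewrite /cexp /= expR0 mul1r.
  apply: cvgC_ReIm => /=; under eq_fun do rewrite exp_sum_imaginary /=.
    by rewrite unlock; exact: is_cvg_series_cos_coeff.
  by rewrite unlock; exact: is_cvg_series_sin_coeff.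
have hxy := cvgM hx hy; rewrite cexpD.
have hd : (exp_sum N (x%:C + (0 +i* y)) -
    exp_sum N x%:C * exp_sum N (0 +i* y) : R[i]) @[N --> \oo] --> (0 : R[i]^o).
  pose b N := exp_sum N `|x| * exp_sum N `|y| - exp_sum N (`|x| + `|y|).
  apply: (@cvgC_squeeze _ _ _ b) => [N|].
    rewrite subr0 -lecR cnormE distrC.
    apply: le_trans (norm_exp_sumM_sub _ _ _) _.
    have -> : `|x%:C| = `|x|%:C :> R[i] by rewrite -cnormE cnormR.
    have -> : `|0 +i* y| = `|y|%:C :> R[i].
      by rewrite normc_def /= expr0n add0r sqrtr_sqr.
    by rewrite -rmorphD !exp_sum_real /b rmorphB rmorphM.
  rewrite -[0 in X in _ --> X](subrr (expR `|x| * expR `|y|)).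
  rewrite -[X in _ --> _ - X]expRD.
  by apply: cvgB; [apply: cvgM|]; apply: exp_sum_cvg.
have -> : (fun N => exp_sum N (x%:C + (0 +i* y))) = (fun N =>
    exp_sum N (x%:C + (0 +i* y)) - exp_sum N x%:C * exp_sum N (0 +i* y) +
    exp_sum N x%:C * exp_sum N (0 +i* y)) :> (nat -> R[i]).
  by apply/funext => N; rewrite subrK.
rewrite -[X in _ --> X]add0r.
exact: (@cvgD R[i] (R[i]^o) nat \oo _ _ _ _ _ hd (hxy _)).
Qed.

(** * Analytic functions of several variables *)

Lemma cvgC_prod (R : realType) (p : nat) (u : 'I_p -> nat -> R[i])
    (l : 'I_p -> R[i]) :
  (forall i, u i @ \oo --> (l i : R[i]^o)) ->
  (fun N => \prod_(i < p) u i N) @ \oo --> (\prod_(i < p) l i : R[i]^o).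
Proof.
move=> h; elim: (index_enum 'I_p) => [|i s IH].
  under eq_fun do rewrite big_nil.
  by rewrite big_nil; exact: (@cvg_cst (R[i]^o)).
under eq_fun do rewrite big_cons.
rewrite big_cons.
exact: (@cvgM R[i] nat \oo _ _ _ _ _ (h i) IH).
Qed.

Lemma cnorm_prod (R : realType) (I : finType) (F : I -> R[i]) :
  cnorm (\prod_i F i) = \prod_i cnorm (F i).
Proof.
apply: (big_morph (fun z : R[i] => cnorm z)) => [z1 z2|]; first exact: cnormM.
by have := cnormR (1 : R); rewrite rmorph1 normr1.
Qed.

(** Summation over a box of multi-indices factorizes: the partial sums of a
    product of one-variable power series are the products of their partial
    sums. Constants, coordinates and exponentials of linear forms are all of
    this kind. *)
Lemma analytic_at_prod (R : realType) (p : nat) (f : 'rV[R[i]]_p -> R[i])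
    (z0 : 'rV[R[i]]_p) (c : 'I_p -> nat -> R[i]) (g : 'I_p -> R[i] -> R[i])
    (M : 'I_p -> R[i] -> R) :
  (forall l w N, \sum_(a < N) cnorm (c l a * w ^+ a) <= M l w) ->
  (forall l w, (fun N => \sum_(a < N) c l a * w ^+ a) @ \oo -->
     (g l w : R[i]^o)) ->
  (forall z, f z = \prod_(l < p) g l ((z - z0) 0 l)) ->
  analytic_at f z0.
Proof.
move=> hM hg hf; exists 1 => //.
exists (fun a : {ffun 'I_p -> nat} => \prod_(l < p) c l (a l)) => z _.
have termE N (a : {ffun 'I_p -> 'I_N}) :
    (\prod_(l < p) c l (box_index a l)) * monomial (z - z0) (box_index a) =
    \prod_(l < p) (c l (a l) * (z - z0) 0 l ^+ a l).
  rewrite /monomial -big_split; apply: eq_bigr => l _.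
  by rewrite /box_index ffunE.
split.
  exists (\prod_(l < p) M l ((z - z0) 0 l)) => N.
  under eq_bigr do rewrite termE cnorm_prod.
  rewrite -(bigA_distr_bigA (fun l (a : 'I_N) =>
    cnorm (c l a * (z - z0) 0 l ^+ a))).
  apply: ler_prod => l _; rewrite hM andbT.
  by apply: sumr_ge0 => a _; exact: cnorm_ge0.
rewrite hf; under eq_fun => N.
  under eq_bigr do rewrite termE.
  rewrite -(bigA_distr_bigA (fun l (a : 'I_N) => c l a * (z - z0) 0 l ^+ a)).
  over.
by apply: cvgC_prod => l; apply: hg.
Qed.

Lemma analytic_atD (R : realType) (p : nat) (f g : 'rV[R[i]]_p -> R[i])
    (z0 : 'rV[R[i]]_p) :
  analytic_at f z0 -> analytic_at g z0 ->
  analytic_at (fun z => f z + g z) z0.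
Proof.
move=> [r1 r10 [c1 h1]] [r2 r20 [c2 h2]].
exists (Num.min r1 r2); first by rewrite lt_min r10 r20.
exists (fun a => c1 a + c2 a) => z; rewrite lt_min => /andP[z1 z2].
have [[M1 hM1] l1] := h1 z z1; have [[M2 hM2] l2] := h2 z z2; split.
  exists (M1 + M2) => N; apply: le_trans (lerD (hM1 N) (hM2 N)).
  rewrite -big_split; apply: ler_sum => a _.
  by rewrite mulrDl cnormD_le.
under eq_fun => N.
  under eq_bigr do rewrite mulrDl.
  rewrite big_split.
  over.
exact: (@cvgD R[i] (R[i]^o) nat \oo _ _ _ _ _ l1 l2).
Qed.

Lemma analytic_atZ (R : realType) (p : nat) (f : 'rV[R[i]]_p -> R[i])
    (b : R[i]) (z0 : 'rV[R[i]]_p) :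
  analytic_at f z0 -> analytic_at (fun z => b * f z) z0.
Proof.
move=> [r r0 [c h]]; exists r => //; exists (fun a => b * c a) => z hz.
have [[M hM] l] := h z hz; split.
  exists (cnorm b * M) => N.
  under eq_bigr do rewrite -mulrA cnormM.
  by rewrite -mulr_sumr ler_wpM2l // cnorm_ge0.
under eq_fun => N.
  under eq_bigr do rewrite -mulrA.
  rewrite -mulr_sumr.
  over.
exact: (@cvgM R[i] nat \oo _ _ _ _ _ (@cvg_cst (R[i]^o) b nat \oo _) l).
Qed.

Lemma monomial_term_cvg (R : realType) (k : nat) (w : R[i]) :
  (fun N => \sum_(a < N) (a == k :> nat)%:R * w ^+ a) @ \oo -->
  (w ^+ k : R[i]^o).
Proof.
apply: (@cvgC_squeeze _ _ _ (fun N => cnorm (w ^+ k) * (N <= k)%N%:R)).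
  move=> N; have [Nk|kN] := leqP N k.
    rewrite big1 => [|a _].
      by rewrite sub0r mulr1 -lecR !cnormE normrN.
    by rewrite ltn_eqF ?mul0r // (leq_trans (ltn_ord a)).
  rewrite (bigD1 (Ordinal kN)) //= eqxx mul1r big1 => [|a ak].
    by rewrite addr0 subrr mulr0 -lecR cnormE normr0.
  by rewrite -val_eqE /= in ak; rewrite (negPf ak) mul0r.
apply: cvg_near_cst; exists k.+1 => // N /=.
by move=> kN; rewrite leqNgt kN mulr0.
Qed.

Lemma monomial_term_bound (R : realType) (k N : nat) (w : R[i]) :
  \sum_(a < N) cnorm ((a == k :> nat)%:R * w ^+ a) <= cnorm (w ^+ k).
Proof.
have [Nk|kN] := leqP N k.
  rewrite big1 ?cnorm_ge0 // => a _.
  by rewrite ltn_eqF ?(leq_trans (ltn_ord a)) // mul0r /cnorm normr0.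
rewrite (bigD1 (Ordinal kN)) //= eqxx mul1r big1 => [|a ak].
  by rewrite addr0.
by rewrite -val_eqE /= in ak; rewrite (negPf ak) mul0r /cnorm normr0.
Qed.

Lemma analytic_at_cst (R : realType) (p : nat) (b : R[i])
    (z0 : 'rV[R[i]]_p) : analytic_at (fun=> b) z0.
Proof.
have -> : (fun=> b) = (fun z : 'rV[R[i]]_p => b * (fun=> 1) z).
  by apply/funext => z; rewrite mulr1.
apply: analytic_atZ.
apply: (@analytic_at_prod _ _ _ _ (fun _ a => (a == 0)%N%:R) (fun _ w => w ^+ 0)
  (fun _ w => cnorm (w ^+ 0))) => [l w N|l w|z].
- exact: monomial_term_bound.
- exact: monomial_term_cvg.
- by rewrite big1 // => l _; rewrite expr0.
Qed.

Lemma analytic_at_coord (R : realType) (p : nat) (j : 'I_p)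
    (z0 : 'rV[R[i]]_p) : analytic_at (fun z => z 0 j) z0.
Proof.
have -> : (fun z : 'rV[R[i]]_p => z 0 j) = (fun z => (z - z0) 0 j + z0 0 j).
  by apply/funext => z; rewrite !mxE subrK.
apply: analytic_atD; last exact: analytic_at_cst.
apply: (@analytic_at_prod _ _ _ _ (fun l a => (a == (l == j))%N%:R)
  (fun l w => w ^+ (l == j))
  (fun l w => cnorm (w ^+ (l == j)))) => [l w N|l w|z].
- exact: monomial_term_bound.
- exact: monomial_term_cvg.
- rewrite (bigD1 j) //= eqxx expr1 big1 ?mulr1 // => l lj.
  by rewrite (negPf lj) expr0.
Qed.

Lemma analytic_at_cexp (R : realType) (p : nat) (v z0 : 'rV[R[i]]_p) :
  analytic_at (fun z => cexp (dot v z)) z0.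
Proof.
have -> : (fun z => cexp (dot v z)) =
    (fun z => cexp (dot v z0) * \prod_(l < p) cexp (v 0 l * (z - z0) 0 l)).
  apply/funext => z; rewrite -cexp_sum -cexpD; congr cexp.
  by rewrite /dot -big_split; apply: eq_bigr => l _ /=; rewrite !mxE; ring.
apply: analytic_atZ.
have termE l w a : (v 0 l) ^+ a / a`!%:R * w ^+ a = (v 0 l * w) ^+ a / a`!%:R.
  by rewrite exprMn mulrAC.
apply: (@analytic_at_prod _ _ _ _ (fun l a => (v 0 l) ^+ a / a`!%:R)
  (fun l w => cexp (v 0 l * w)) (fun l w => expR (cnorm (v 0 l * w)))) => //.
- move=> l w N; apply: le_trans (exp_sum_le N (cnorm_ge0 _)).
  apply: ler_sum => a _; rewrite termE.
  rewrite -lecR cnormE normrM normfV normrX normr_nat -cnormE.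
  by rewrite rmorphM fmorphV rmorphXn /= rmorph_nat.
- move=> l w; under eq_fun => N do under eq_bigr do rewrite termE.
  exact: exp_sum_cvg_cexp.
Qed.

(** * The complex domain and the supremum norm *)

Lemma norm_mx_coord (K : numDomainType) (p q : nat) (x : 'M[K]_(p, q)) i j :
  `|x i j| <= `|x|.
Proof.
have -> : `|x| = mx_norm x by [].
rewrite mx_normE; have -> : `|x i j| = (`|x i j|%:nng)%:num by [].
by rewrite num_le; apply: (le_bigmax _ (fun k => `|x k.1 k.2|%:nng) (i, j)).
Qed.

Lemma cnorm_mx_coord (R : realType) (p q : nat) (x : 'M[R[i]]_(p, q)) i j :
  cnorm (x i j) <= cnorm x.
Proof. by rewrite -lecR !cnormE norm_mx_coord. Qed.

Lemma Vdom_Im (R : realType) (n : nat) (b : 'rV[R]_n) (r sigma : R) z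
    (u : 'rV[R]_n) : Vdom b r sigma z ->
  `|complex.Im (dot (toC u) (lsubmx z))| <= (\sum_(l < n) `|u 0 l|) * sigma.
Proof.
move=> [hz _]; rewrite mulr_suml /dot raddf_sum.
apply: le_trans (ler_norm_sum _ _ _) _; apply: ler_sum => l _ /=.
have -> : complex.Im (toC u 0 l * lsubmx z 0 l) =
    u 0 l * (map_mx (@complex.Im R) (lsubmx z)) 0 l.
  by rewrite !mxE; case: (z _ _) => x y /=; rewrite mul0r addr0.
rewrite normrM ler_wpM2l //; apply: le_trans (norm_mx_coord _ _ _) (ltW hz).
Qed.

Lemma Vdom_action (R : realType) (n : nat) (b : 'rV[R]_n) (r sigma : R) z
    (j : 'I_n) : 0 < r -> Vdom b r sigma z ->
  cnorm (rsubmx z 0 j - (b 0 j)%:C) <= r + sigma.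
Proof.
move=> r0 [_ hz]; have [|_ [x hx <-] hxz] := inf_lt _ hz.
  by exists (cnorm (rsubmx z - toC b)); exists b => //; apply: ballxx.
have -> : rsubmx z 0 j - (b 0 j)%:C =
    (rsubmx z - toC x) 0 j + (x 0 j - b 0 j)%:C.
  by rewrite !mxE rmorphB /= addrA subrK.
apply: le_trans (cnormD_le _ _) _; rewrite addrC; apply: lerD.
  rewrite cnormR distrC; have [_ /(_ 0 j)] := hx.
  by rewrite -ball_normE => /ltW.
by apply: le_trans (cnorm_mx_coord _ _ _) (ltW hxz).
Qed.

Lemma Vdom_center (R : realType) (n : nat) (b : 'rV[R]_n) (r sigma : R) :
  0 < r -> 0 < sigma -> Vdom b r sigma (row_mx 0 (toC b)).
Proof.
move=> r0 s0; rewrite /Vdom /=; split.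
  by rewrite row_mxKl (_ : map_mx _ _ = 0) ?normr0 //; apply/matrixP => i j;
    rewrite !mxE.
rewrite row_mxKr; apply: le_lt_trans s0; apply: ge_inf.
  by exists 0 => _ [x _ <-]; apply: cnorm_ge0.
by exists b; [exact: ballxx|rewrite subrr /cnorm normr0].
Qed.

(** The supremum of |C + g| is a 1-Lipschitz function of C; it is at most e
    at C = 0 and at least e at C = 2 e. *)
Lemma shift_to_sup_norm (R : realType) (T : Type) (V : set T) (g : T -> R[i])
    (e : R) : V !=set0 -> (forall z, V z -> cnorm (g z) <= e) ->
  exists C : R, ereal_sup [set (cnorm (C%:C + g z))%:E | z in V] = e%:E.
Proof.
move=> [z0 Vz0] ge.
have e0 : 0 <= e by apply: le_trans (ge _ Vz0); apply: cnorm_ge0.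
pose S C := [set cnorm (C%:C + g z) | z in V].
have Sub C : ubound (S C) (`|C| + e).
  move=> _ [z Vz <-]; apply: le_trans (cnormD_le _ _) _.
  by rewrite cnormR lerD2l ge.
have S0 C : S C !=set0 by exists (cnorm (C%:C + g z0)); exists z0.
pose phi C := sup (S C).
have phi_ub C z : V z -> cnorm (C%:C + g z) <= phi C.
  move=> Vz; apply: ub_le_sup; first by exists (`|C| + e); apply: Sub.
  by exists z.
have lip C C' : phi C <= phi C' + `|C - C'|.
  apply: ge_sup => // _ [z Vz <-].
  have -> : C%:C + g z = (C'%:C + g z) + (C - C')%:C.
    by rewrite rmorphB /=; ring.
  apply: le_trans (cnormD_le _ _) _; rewrite cnormR lerD2r; exact: phi_ub.
have cont : continuous phi.
  move=> C; apply/cvgrPdist_lt => d d0; near=> C'.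
  have hC : `|C - C'| < d.
    by near: C'; have /cvgrPdist_lt := @cvg_id _ (nbhs C); apply.
  apply: le_lt_trans hC; rewrite ler_norml.
  by have := lip C C'; have := lip C' C; rewrite (distrC C'); lra.
have [|||C _ hC] := @IVT R phi 0 (e + e) e.
- by lra.
- exact: continuous_subspaceT.
- rewrite ge_min le_max; apply/andP; split; apply/orP; [left|right].
    by apply: ge_sup => // _ [z Vz <-]; rewrite rmorph0 add0r ge.
  apply: le_trans (phi_ub _ _ Vz0).
  have := cnormD_le ((e + e)%:C + g z0) (- g z0).
  have -> : cnorm (- g z0) = cnorm (g z0) by rewrite /cnorm normrN.
  by rewrite addrK cnormR ger0_norm; have := ge _ Vz0; lra.
exists C; rewrite -hC -ereal_sup_EFin //; last by exists (`|C| + e).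
by congr ereal_sup; rewrite -image_comp.
Unshelve. all: by end_near.
Qed.

(** * The resonant perturbation *)

Definition csin (R : realType) (z : R[i]) : R[i] :=
  (cexp ('i * z) - cexp (- 'i * z)) / (2 * 'i).

Lemma csin_real (R : realType) (x : R) : csin x%:C = (sin x)%:C.
Proof.
rewrite /csin /cexp /=.
rewrite !(mul0r, mul1r, mulr0, addr0, add0r, subr0, mulN1r, oppr0).
rewrite !expR0 cosN sinN.
have i0 : 2 * 'i != 0 :> R[i] by rewrite mulf_neq0 ?pnatr_eq0 // neq0Ci.
apply: (canLR (mulfK i0)); apply/eqP; rewrite eq_complex /=.
by apply/andP; split; apply/eqP; ring.
Qed.

Lemma cnorm_csin_le (R : realType) (z : R[i]) :
  cnorm (csin z) <= expR `|complex.Im z|.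
Proof.
rewrite /csin cnormM.
have -> : cnorm ((2 * 'i)^-1 : R[i]) = 2^-1.
  apply: complexI; rewrite cnormE normfV normrM normr_nat.
  by rewrite normc_def /= expr0n add0r expr1n sqrtr1 mulr1 fmorphV rmorph_nat.
have -> : expR `|complex.Im z| =
    (expR `|complex.Im z| + expR `|complex.Im z|) * 2^-1 by field.
rewrite ler_wpM2r // ?invr_ge0 //; apply: le_trans (cnormD_le _ _) _.
have -> : cnorm (- cexp (- 'i * z)) = cnorm (cexp (- 'i * z)).
  by rewrite /cnorm normrN.
rewrite !cnorm_cexp; case: z => x y /=.
rewrite !(mul0r, mul1r, oppr0, sub0r, mulN1r) opprK.
by apply: lerD; rewrite ler_expR ?ler_norm // -(normrN y) ler_norm.
Qed.

Lemma csin_periodic (R : realType) (z : R[i]) (k : int) :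
  csin (z + (2 * pi * k%:~R)%:C) = csin z.
Proof.
have period w : cexp (w + 'i * (2 * pi)%:C) = cexp w :> R[i].
  rewrite cexpD [X in _ * X](_ : _ = 1) ?mulr1 // /cexp /=.
  rewrite !(mul0r, mul1r, mulr0, addr0, add0r, oppr0) expR0 mul1r.
  by rewrite mulr_natl cos2pi sin2pi.
have periodn w (n : nat) : cexp (w + 'i * (2 * pi * n%:R)%:C) = cexp w :> R[i].
  elim: n => [|n IH]; first by rewrite mulr0 rmorph0 mulr0 addr0.
  rewrite -[RHS]IH -[RHS]period; congr cexp.
  by rewrite -[n.+1%:R]natr1 mulrDr mulr1 rmorphD /= mulrDr addrA.
have periodz w (n : int) : cexp (w + 'i * (2 * pi * n%:~R)%:C) = cexp w :> R[i].
  case: n => n; first exact: periodn.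
  rewrite NegzE -[LHS](periodn _ n.+1); congr cexp.
  by rewrite -addrA -mulrDr -rmorphD /= mulrNz -mulrDr addNr mulr0 mulr0 addr0.
rewrite /csin mulrDr periodz mulNr mulrDr opprD.
have -> : - ('i * (2 * pi * k%:~R)%:C) = 'i * (2 * pi * (- k)%:~R)%:C :> R[i].
  by rewrite mulrNz mulrN rmorphN mulrN.
by rewrite periodz mulNr.
Qed.

Definition resonant_perturbation (R : realType) (n : nat) (b : 'rV[R]_n)
    (j : 'I_n) (u : 'rV[R]_n) (C delta mu : R) (z : 'rV[R[i]]_(n + n)) : R[i] :=
  C%:C + (delta%:C * (rsubmx z 0 j - (b 0 j)%:C) +
          mu%:C * csin (dot (toC u) (lsubmx z))).

Lemma dot_toC (R : realType) (n : nat) (u v : 'rV[R]_n) :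
  dot (toC u) (toC v) = (dot u v)%:C.
Proof.
by rewrite /dot raddf_sum; apply: eq_bigr => l _; rewrite !mxE -rmorphM.
Qed.

Lemma resonant_perturbation_real (R : realType) (n : nat) (b : 'rV[R]_n) j u
    C delta mu (theta I : 'rV[R]_n) :
  resonant_perturbation b j u C delta mu (row_mx (toC theta) (toC I)) =
  (C + (delta * (I 0 j - b 0 j) + mu * sin (dot u theta)))%:C.
Proof.
rewrite /resonant_perturbation row_mxKl row_mxKr dot_toC csin_real mxE.
by rewrite -rmorphB -!rmorphM -!rmorphD.
Qed.

Lemma dotDr (R : pzRingType) (n : nat) (u v w : 'rV[R]_n) :
  dot u (v + w) = dot u v + dot u w.
Proof. by rewrite -big_split; apply: eq_bigr => i _; rewrite mxE mulrDr. Qed.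

Lemma dotZr (R : comPzRingType) (n : nat) (a : R) (u w : 'rV[R]_n) :
  dot u (a *: w) = a * dot u w.
Proof.
by rewrite /dot mulr_sumr; apply: eq_bigr => i _; rewrite mxE mulrCA.
Qed.

Lemma dot_delta (R : pzRingType) (n : nat) (u : 'rV[R]_n) (i : 'I_n) :
  dot u (delta_mx 0 i) = u 0 i.
Proof.
rewrite /dot (bigD1 i) //= big1 => [|l li].
  by rewrite mxE !eqxx mulr1 addr0.
by rewrite mxE (negPf li) andbF mulr0.
Qed.

Lemma resonant_perturbation_periodic (R : realType) (n : nat) (b : 'rV[R]_n) j
    (k : 'rV[int]_n) C delta mu (U : set 'rV[R[i]]_(n + n)) :
  torus_periodic U
    (resonant_perturbation b j ((2 * pi) *: map_mx intr k) C delta mu).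
Proof.
move=> z d _; rewrite /resonant_perturbation.
rewrite -{1 2}[z]hsubmxK add_row_mx row_mxKl row_mxKr addr0.
congr (_ + (_ + _ * _)); rewrite (dotDr _ (lsubmx z)).
have -> : dot (toC ((2 * pi : R) *: map_mx intr k)) (map_mx intr d) =
    (2 * pi * (dot k d)%:~R)%:C.
  rewrite /dot raddf_sum /= mulr_sumr raddf_sum; apply: eq_bigr => l _ /=.
  by rewrite !mxE intrM !rmorphM /= !rmorph_int mulrA.
exact: csin_periodic.
Qed.

Lemma resonant_perturbation_analytic (R : realType) (n : nat) (b : 'rV[R]_n) j
    u C delta mu (U : set 'rV[R[i]]_(n + n)) :
  analytic_on U (resonant_perturbation b j u C delta mu).
Proof.
move=> z0 _; apply: analytic_atD; first exact: analytic_at_cst.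
apply: analytic_atD; apply: analytic_atZ.
  apply: analytic_atD; last exact: analytic_at_cst.
  have -> : (fun z : 'rV[R[i]]_(n + n) => rsubmx z 0 j) =
      (fun z => z 0 (rshift n j)) by apply/funext => z; rewrite mxE.
  exact: analytic_at_coord.
have dotE (a : R[i]) (z : 'rV[R[i]]_(n + n)) :
    a * dot (toC u) (lsubmx z) = dot (row_mx (a *: toC u) 0) z.
  rewrite -[in RHS](hsubmxK z) dot_row_mx dotZl.
  by rewrite [X in _ + X]big1 ?addr0 // => l _; rewrite mxE mul0r.
have -> : (fun z => csin (dot (toC u) (lsubmx z))) =
    (fun z => (2 * 'i)^-1 * (cexp (dot (row_mx ('i *: toC u) (0 : 'rV_n)) z) +
       (- 1) * cexp (dot (row_mx ((- 'i) *: toC u) (0 : 'rV_n)) z))).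
  by apply/funext => z; rewrite /csin (dotE 'i z) (dotE (- 'i) z) mulN1r;
    exact: mulrC.
by apply: analytic_atZ; apply: analytic_atD; [|apply: analytic_atZ];
  apply: analytic_at_cexp.
Qed.

Lemma resonant_perturbation_bound (R : realType) (n : nat) (b : 'rV[R]_n) j u
    delta mu (r sigma : R) z : 0 < r -> Vdom b r sigma z ->
  cnorm (delta%:C * (rsubmx z 0 j - (b 0 j)%:C) +
          mu%:C * csin (dot (toC u) (lsubmx z))) <=
  `|delta| * (r + sigma) + `|mu| * expR ((\sum_(l < n) `|u 0 l|) * sigma).
Proof.
move=> r0 hz; apply: le_trans (cnormD_le _ _) _.
rewrite (cnormM delta%:C) (cnormM mu%:C) !cnormR.
apply: lerD; apply: ler_wpM2l => //; first exact: Vdom_action hz.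
apply: le_trans (cnorm_csin_le _) _.
by rewrite ler_expR; apply: Vdom_Im hz.
Qed.

(** * Orbits of the perturbed system *)

Lemma derive_along_line (R : realType) (n : nat) (f : 'rV[R]_n -> R)
    (a v : 'rV[R]_n) (d : R) :
  is_derive (0 : R) 1 (fun h : R => f (h *: v + a)) d -> 'D_v f a = d.
Proof.
move=> [_ <-]; rewrite /derive; rewrite /= scale0r add0r.
rewrite (_ : (fun h => h^-1 *: ((f \o shift a) (h *: v) - f a)) =
  (fun h : R => h^-1 *: (((fun h0 : R => f (h0 *: v + a)) \o shift 0) (h *: 1) -
     f a))) //.
by apply/funext => h; rewrite /= addr0 [h *: 1]mulr1.
Qed.

Lemma is_derive_affine (R : realType) (c d t : R) :
  is_derive t 1 (fun h : R => c * h + d) c.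
Proof. by apply: is_derive_eq; rewrite addr0 [_ *: 1]mulr1. Qed.

Lemma derive_action (R : realType) (n : nat) (w : 'rV[R]_n) (b : 'rV[R]_n)
    j u C delta mu (theta I : 'rV[R]_n) (i : 'I_n) :
  'D_(delta_mx 0 i)
    (perturbed w (resonant_perturbation b j u C delta mu) theta) I =
  (w + delta *: delta_mx 0 j) 0 i.
Proof.
apply: derive_along_line.
have -> : (fun h : R => perturbed w (resonant_perturbation b j u C delta mu)
    theta (h *: delta_mx 0 i + I)) =
  (fun h => (w + delta *: delta_mx 0 j) 0 i * h +
    perturbed w (resonant_perturbation b j u C delta mu) theta I).
  apply/funext => h; rewrite /perturbed !resonant_perturbation_real /=.
  rewrite dotDr dotZr dot_delta !mxE eqxx /= [i == j]eq_sym; ring.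
exact: is_derive_affine.
Qed.

Lemma derive_angle (R : realType) (n : nat) (w : 'rV[R]_n) (b : 'rV[R]_n)
    j u C delta mu (theta I : 'rV[R]_n) (i : 'I_n) :
  'D_(delta_mx 0 i)
    ((perturbed w (resonant_perturbation b j u C delta mu)) ^~ I) theta =
  mu * cos (dot u theta) * u 0 i.
Proof.
apply: derive_along_line.
have -> : (fun h : R => perturbed w (resonant_perturbation b j u C delta mu)
    (h *: delta_mx 0 i + theta) I) =
  (fun h => (dot w I + C + delta * (I 0 j - b 0 j)) +
     mu * sin (u 0 i * h + dot u theta)).
  apply/funext => h; rewrite /perturbed !resonant_perturbation_real /=.
  by rewrite dotDr dotZr dot_delta; rewrite [h * _]mulrC; ring.
have hs : is_derive (0 : R) 1 (sin \o (fun h => u 0 i * h + dot u theta))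
    (cos (dot u theta) * u 0 i).
  apply: is_derive1_comp.
    by rewrite mulr0 add0r; exact: is_derive_sin.
  exact: is_derive_affine.
by apply: is_derive_eq; rewrite add0r mul1r -mulrA.
Qed.

Lemma constant_derivative_affine (R : realType) (J : set R) (f : R -> R)
    (d : R) : is_interval J -> J 0 ->
  (forall t, J t -> is_derive t 1 f d) -> forall t, J t -> f t = f 0 + t * d.
Proof.
move=> Jint J0 hf t Jt.
have cont a b : J a -> J b -> {within `[a, b], continuous f}.
  move=> Ja Jb; apply: derivable_within_continuous => x.
  rewrite in_itv /= => xab.
  by have [] := hf x (Jint a b Ja Jb x xab).
have seg a b : a <= b -> J a -> J b -> f b - f a = d * (b - a).
  move=> ab Ja Jb.
  have deriv x : x \in `]a, b[ -> is_derive x 1 f d.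
    rewrite in_itv /= => /andP[ax xb]; apply: hf.
    by apply: (Jint a b Ja Jb); rewrite (ltW ax) (ltW xb).
  by have [c _ ->] := MVT_segment ab deriv (cont a b Ja Jb).
have [t0|t0] := leP 0 t.
  by have := seg 0 t t0 J0 Jt; rewrite subr0 => h; lra.
by have := seg t 0 (ltW t0) Jt J0; rewrite sub0r => h; lra.
Qed.

(** The frequency w + delta e_j does not depend on the orbit because the
    Hamiltonian is affine in the action. Along any orbit issued from (0, b)
    the angle is therefore linear in time and the phase u.theta stays equal
    to 0, which forces the action to be affine: this gives the orbit as well
    as its maximality. *)
Lemma resonant_drift (R : realType) (n : nat) (w b : 'rV[R]_n) (j : 'I_n)
    (u : 'rV[R]_n) (C delta mu r : R)
    (H := perturbed w (resonant_perturbation b j u C delta mu)) :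
  0 < r -> u != 0 -> 0 < mu -> dot u w + delta * u 0 j = 0 ->
  exists (J : set R) (theta I : R -> 'rV[R]_n),
    maximal_orbit_in_D b r H J theta I /\
    forall t : R, J t -> `|I t - I 0| = `|t| * (mu * `|u|).
Proof.
move=> r0 u0 mu0 res.
pose w' := w + delta *: delta_mx 0 j.
have uw' : dot u w' = 0 by rewrite dotDr dotZr dot_delta.
pose theta (t : R) := t *: w'.
pose I (t : R) := b - t *: (mu *: u).
pose v := mu * `|u|; have v0 : 0 < v by rewrite mulr_gt0 // normr_gt0.
have normI t : `|I t - b| = `|t| * v.
  by rewrite /I addrC addKr normrN !mx_normZ (gtr0_norm mu0).
have inB t : ball b r (I t) <-> ball (0 : R) (r / v) t.
  rewrite -!ball_normE /= distrC normI sub0r normrN ltr_pdivlMr //.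
pose J : set R := ball (0 : R) (r / v).
have J0 : J 0 by apply: ballxx; apply: divr_gt0.
exists J, theta, I; split; last first.
  by move=> t _; have := normI t; rewrite {3}/I scale0r subr0.
split.
  split.
  - exact: ball_open.
  - by rewrite /J ball_itv; exact: interval_is_interval.
  - exact: J0.
  - by move=> t /inB.
  - move=> t i _; split; [rewrite derive_action|rewrite derive_angle].
      have -> : (fun s => theta s 0 i) = (fun s => w' 0 i * s + 0).
        by apply/funext => s; rewrite mxE addr0 mulrC.
      exact: is_derive_affine.
    have -> : dot u (theta t) = 0 by rewrite dotZr uw' mulr0.
    have -> : (fun s => I s 0 i) = (fun s => - (mu * u 0 i) * s + b 0 i).
      by apply/funext => s; rewrite !mxE; ring.
    rewrite cos0 mulr1; exact: is_derive_affine.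
move=> J' theta' I' [_ Jint J'0 inball sol] theta0 I0 t J't; apply/inB.
have thetaE s : J' s -> theta' s = s *: w'.
  move=> J's; apply/rowP => i.
  have der s' : J' s' -> is_derive s' 1 (fun s => theta' s 0 i) (w' 0 i).
    by move=> J's'; have [+ _] := sol s' i J's'; rewrite derive_action.
  have /= -> := constant_derivative_affine Jint J'0 der J's.
  by rewrite theta0 /theta scale0r !mxE add0r.
suff -> : I t = I' t by apply: inball.
apply/rowP => i.
have der s : J' s -> is_derive s 1 (fun s => I' s 0 i) (- (mu * u 0 i)).
  move=> J's; have [_] := sol s i J's.
  by rewrite derive_angle thetaE // dotZr uw' mulr0 cos0 mulr1.
have /= -> := constant_derivative_affine Jint J'0 der J't.
by rewrite I0 /I scale0r !mxE; ring.
Qed.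

(** * Choice of the parameters *)

(** The two smallness hypotheses bound the linear term and the sine by eps / 2
    each; the factor 1 / 2 for the sine comes from the inequality
    2 <= 2 pi |k| between the speed v and the amplitude mu = v / (2 pi |k|). *)
Lemma drifting_perturbation (R : realType) (n : nat) (w b : 'rV[R]_n)
    (k : 'rV[int]_n) (j : 'I_n) (delta eps v r sigma : R) :
  0 < r -> 0 < sigma -> 0 < v -> k 0 j != 0 ->
  dot (map_mx intr k) w + delta * (k 0 j)%:~R = 0 ->
  `|delta| * (r + sigma) <= eps / 2 ->
  v * expR (2 * pi * (\sum_(l < n) `|k 0 l|)%:~R * sigma) <= eps ->
  exists f : 'rV[R[i]]_(n + n) -> R[i],
    [/\ [/\ torus_periodic (Vdom b r sigma) f,
            analytic_on (Vdom b r sigma) f & real_on_D b r f],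
        sup_norm b r sigma f = eps%:E &
        exists (J : set R) (theta I : R -> 'rV[R]_n),
          maximal_orbit_in_D b r (perturbed w f) J theta I /\
          forall t : R, J t -> `|I t - I 0| = `|t| * v].
Proof.
move=> r0 s0 v0 kj res hdelta hv.
have pi0 : 0 < pi :> R by exact: pi_gt0.
pose u : 'rV[R]_n := (2 * pi) *: map_mx intr k.
have u2 : 2 <= `|u|.
  apply: le_trans (norm_mx_coord u 0 j).
  rewrite !mxE normrM ger0_norm; last by rewrite mulr_ge0 // ltW.
  have : 1 <= `|(k 0 j)%:~R| :> R by rewrite -intr_norm (ler_int _ 1); lia.
  have := pi_ge2 R.
  by move: `|_| => a; nra.
have nu0 : 0 < `|u| by lra.
have u0 : u != 0 by rewrite -normr_gt0.
pose mu := v / `|u|.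
have mu0 : 0 < mu by rewrite divr_gt0.
have muu : mu * `|u| = v by rewrite divfK // gt_eqF.
have resu : dot u w + delta * u 0 j = 0.
  by rewrite dotZl !mxE mulrCA -mulrDr res mulr0.
have [|C hC] := @shift_to_sup_norm R _ (Vdom b r sigma)
  (fun z => delta%:C * (rsubmx z 0 j - (b 0 j)%:C) +
            mu%:C * csin (dot (toC u) (lsubmx z))) eps
  (ex_intro _ _ (Vdom_center b r0 s0)) _.
  move=> z hz; apply: le_trans (resonant_perturbation_bound _ _ _ _ r0 hz) _.
  have -> : \sum_(l < n) `|u 0 l| = 2 * pi * (\sum_(l < n) `|k 0 l|)%:~R.
    rewrite raddf_sum mulr_sumr; apply: eq_bigr => l _ /=.
    by rewrite !mxE normrM ger0_norm ?intr_norm // mulr_ge0 // ltW.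
  rewrite (gtr0_norm mu0).
  have : mu * 2 <= v by rewrite -muu ler_pM2l.
  move: hv; have := expR_gt0 (2 * pi * (\sum_(l < n) `|k 0 l|)%:~R * sigma).
  by move: (expR _) => E E0 hE hmu; nra.
exists (resonant_perturbation b j u C delta mu); split.
- split.
  + exact: resonant_perturbation_periodic.
  + exact: resonant_perturbation_analytic.
  + by move=> theta I _; rewrite resonant_perturbation_real.
- exact: hC.
by have := resonant_drift b C r0 u0 mu0 resu; rewrite muu.
Qed.

Lemma Psi_int_attained (R : realType) (m K : nat) (alpha : 'rV[R]_m) :
  (0 < m)%N -> (0 < K)%N -> nonresonant (omega alpha) ->
  exists2 d : 'rV[int]_m, (0 < supnormZ d <= K)%N &
    [/\ 0 < distZ (dot (map_mx intr d) alpha),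
        Psi_int alpha K = (distZ (dot (map_mx intr d) alpha))^-1 &
        forall d' : 'rV[int]_m, (0 < supnormZ d' <= K)%N ->
          distZ (dot (map_mx intr d) alpha) <=
          distZ (dot (map_mx intr d') alpha)].
Proof.
move=> m0 K0 hres; have [d dK dbest] := best_approximation alpha m0 K0.
have pos d' : (0 < supnormZ d')%N -> 0 < distZ (dot (map_mx intr d') alpha).
  rewrite supnormZ_gt0 => d'0.
  have [p ->] := distZ_attained (dot (map_mx intr d') alpha).
  by rewrite normr_gt0 nonresonant_form_neq0.
have dpos := pos d (proj1 (andP dK)).
exists d => //; split=> //; apply/le_anti/andP; split.
  apply: ge_sup.
    by exists (distZ (dot (map_mx intr d) alpha))^-1; exists d.
  move=> _ [d' d'K <-]; rewrite lef_pV2 ?dbest // posrE // pos //.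
  by case/andP: d'K.
apply: ub_le_sup; last by exists d.
exists (distZ (dot (map_mx intr d) alpha))^-1 => _ [d' d'K <-].
by rewrite lef_pV2 ?dbest // posrE // pos //; case/andP: d'K.
Qed.

Lemma Lambda_lt (R : realType) (Psi : R -> R) (x y : R) :
  0 < Psi 1 -> {in `[1, +oo[ &, {homo Psi : x y / x <= y}} ->
  1 <= x -> x < y -> Lambda Psi x < Lambda Psi y.
Proof.
move=> P1 mono x1 xy; have y1 : 1 <= y := le_trans x1 (ltW xy).
have in1 z : 1 <= z -> z \in `[1, +oo[ by move=> z1; rewrite in_itv /= z1.
have hx : Psi 1 <= Psi x by apply: mono; rewrite ?in1.
have hxy : Psi x <= Psi y by apply: mono; rewrite ?in1 // ltW.
rewrite /Lambda; nra.
Qed.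

(** Lambda is strictly increasing on [1, +oo[, as the product of the identity
    and of a positive nondecreasing function. *)
Lemma Delta_Lambda (R : realType) (Psi : R -> R) (x : R) :
  0 < Psi 1 -> {in `[1, +oo[ &, {homo Psi : x y / x <= y}} ->
  1 <= x -> Delta Psi (Lambda Psi x) = x.
Proof.
move=> P1 mono x1.
have mem1 (z : R) : z \in `[1, +oo[%classic -> 1 <= z.
  by rewrite inE /= in_itv /= andbT.
apply: pinvKV; last by rewrite inE /= in_itv /= x1.
move=> y z /mem1 y1 /mem1 z1 yz; apply: contrapT => /eqP.
rewrite neq_lt => /orP[lt|lt].
  by have := Lambda_lt P1 mono y1 lt; rewrite yz ltxx.
by have := Lambda_lt P1 mono z1 lt; rewrite yz ltxx.
Qed.

Lemma sum_abs_le_supnormZ (m : nat) (k : 'rV[int]_m) :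
  \sum_(i < m) `|k 0 i| <= (m * supnormZ k)%N%:Z.
Proof.
apply: (@le_trans _ _ (\sum_(i < m) (supnormZ k)%:Z)).
  apply: ler_sum => i _; rewrite -abszE lez_nat.
  by have /supnormZ_leP := leqnn (supnormZ k); apply.
by rewrite sumr_const card_ord; lia.
Qed.

(** The integer p is close to k.alpha, whose size is at most m |k| since the
    coordinates of alpha are below 1. *)
Lemma resonant_vector_size (R : realType) (m : nat) (alpha : 'rV[R]_m)
    (k : 'rV[int]_m) (p : int) :
  k != 0 -> (forall i, `|alpha 0 i| < 1) ->
  `|dot (map_mx intr k) alpha - p%:~R| < 1 ->
  `|p| + \sum_(i < m) `|k 0 i| <= ((2 * m + 1) * supnormZ k)%N%:Z.
Proof.
rewrite -supnormZ_gt0 => q0 ha hL.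
have hk := sum_abs_le_supnormZ k.
have hdot : `|dot (map_mx intr k) alpha| <= (m * supnormZ k)%N%:R.
  have -> : ((m * supnormZ k)%N%:R : R) = ((m * supnormZ k)%N%:Z)%:~R by [].
  apply: (@le_trans _ _ ((\sum_(i < m) `|k 0 i|)%:~R)); last by rewrite ler_int.
  rewrite raddf_sum; apply: le_trans (ler_norm_sum _ _ _) _.
  apply: ler_sum => i _ /=; rewrite mxE normrM -intr_norm ler_piMr //.
  exact: ltW.
have : `|p|%:~R < (m * supnormZ k + 1)%N%:Z%:~R :> R.
  rewrite intr_norm.
  have -> : p%:~R = dot (map_mx intr k) alpha -
      (dot (map_mx intr k) alpha - p%:~R) by ring.
  apply: le_lt_trans (ler_normB _ _) _.
  have -> : ((m * supnormZ k + 1)%N%:Z%:~R : R) = (m * supnormZ k)%N%:R + 1.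
    by rewrite -[LHS]/((m * supnormZ k + 1)%N%:R) natrD.
  exact: ler_ltD.
rewrite ltr_int => hp; move: hk hp q0.
move: (\sum_(i < m) _) (supnormZ k) => s q; nia.
Qed.
(* The dimension is n = m.+1, so that n >= 2 reads 1 <= m. *)
Theorem theorem1p3 (R : realType) (m : nat) (hm : (1 <= m)%N) (r sigma : R)
    (hr : 1 < r) (hsigma : 0 < sigma) (alpha : 'rV[R]_m)
    (halpha : forall i : 'I_m, `|alpha 0 i| < 1)
    (hres : nonresonant (omega alpha))
    (Psi : R -> R) (hPsi : Psi_extension alpha Psi) :
  exists2 c : R, 0 < c &
  forall b : 'rV[R]_m.+1,
  exists (f : nat -> 'rV[R[i]]_(m.+1 + m.+1) -> R[i]) (eps : nat -> R),
    eps @ \oo --> (0 : R) /\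
    forall j : nat, (1 <= j)%N ->
      [/\ [/\ torus_periodic (Vdom b r sigma) (f j),
              analytic_on (Vdom b r sigma) (f j) &
              real_on_D b r (f j)],
          sup_norm b r sigma (f j) = (eps j)%:E,
          0 < eps j /\ Lambda Psi 1 <= c * (eps j)^-1 &
          exists (J : set R) (theta I : R -> 'rV[R]_m.+1),
            maximal_orbit_in_D b r (perturbed (omega alpha) (f j)) J theta I /\
            forall t : R, J t ->
              `|I t - I 0| =
              `|t| * eps j
                * expR (- (2 * sigma * Delta Psi (c * (eps j)^-1)))].
Proof.
have [PsiE _ Pmono] := hPsi.
have r0 : 0 < r := lt_trans ltr01 hr.
have pi0 : 0 < pi :> R by exact: pi_gt0.
have Psi1 : 0 < Psi 1.
  have [d _ [dpos dE _]] := Psi_int_attained hm (ltn0Sn 0) hres.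
  by rewrite (PsiE 1%N) // dE invr_gt0.
pose A := Num.bound (pi * (2 * m + 1)%:R : R).
have Api : pi * (2 * m + 1)%:R < A%:R :> R.
  by apply: archi_boundP; rewrite mulr_ge0 // ltW.
have A0r : 0 < A%:R :> R by apply: le_lt_trans Api; rewrite mulr_ge0 // ltW.
have A0 : (0 < A)%N by rewrite -(ltr_nat R).
have [M M0 approx] := quasi_best_approximations hm A0 hres.
pose c := 2 * (r + sigma) * A%:R * M.
have c0 : 0 < c by rewrite !mulr_gt0 // addr_gt0.
exists c => // b.
have /choice [kp hkp] (j : nat) : exists kp : 'rV[int]_m * int,
    let L := dot (map_mx intr kp.1) alpha - kp.2%:~R in
    [/\ kp.1 != 0, `|L| < j.+1%:R^-1 &
        forall d : 'rV[int]_m, (0 < supnormZ d <= A * supnormZ kp.1)%N ->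
          `|L| <= M * distZ (dot (map_mx intr d) alpha)].
  by have [|k [p h]] := approx j.+1%:R^-1; [rewrite invr_gt0|exists (k, p)].
pose q j := supnormZ (kp j).1.
pose L j := dot (map_mx intr (kp j).1) alpha - (kp j).2%:~R.
pose Q j : R := (A * q j)%N%:R.
pose eps j := c / Lambda Psi (Q j).
have q0 j : (0 < q j)%N by rewrite supnormZ_gt0; have [] := hkp j.
have Aq0 j : (0 < A * q j)%N by rewrite muln_gt0 A0 q0.
have Q1 j : 1 <= Q j by rewrite ler1n.
have LPsi j : [/\ 0 < Psi (Q j), `|L j| * Psi (Q j) <= M &
    1 <= `|L j| * Psi (Q j)].
  have [d hd [dpos dE dbest]] := Psi_int_attained hm (Aq0 j) hres.
  have [kneq0 _ hL] := hkp j; rewrite /Q PsiE // dE invr_gt0; split=> //.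
    by rewrite ler_pdivrMr //; apply: hL.
  rewrite ler_pdivlMr // mul1r.
  apply: le_trans (distZ_le _ (kp j).2); apply: dbest.
  by rewrite q0 leq_pmull.
have Lam0 j : 0 < Lambda Psi (Q j).
  have [Psi0 _ _] := LPsi j; rewrite mulr_gt0 //.
  exact: lt_le_trans ltr01 (Q1 j).
have eps0 j : 0 < eps j by rewrite divr_gt0.
have cepsE j : c * (eps j)^-1 = Lambda Psi (Q j).
  by rewrite /eps invf_div mulrC divfK // gt_eqF.
have epsL j : eps j <= c * `|L j|.
  rewrite /eps ler_pdivrMr // -mulrA ler_peMr ?(ltW c0) //.
  have [Psi0 _ h1] := LPsi j; have := Q1 j; rewrite /Lambda.
  by rewrite mulrCA => hQ; apply: le_trans (ler_peMl _ hQ); lra.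
have LambdaLe j : Lambda Psi 1 <= Lambda Psi (Q j).
  have := Q1 j; rewrite le_eqVlt => /orP[/eqP <- //|hlt].
  exact/ltW/Lambda_lt.
pose v j := eps j * expR (- (2 * sigma * Delta Psi (c * (eps j)^-1))).
have v0 j : 0 < v j by rewrite mulr_gt0 // expR_gt0.
have /choice [f hf] (j : nat) : exists f : 'rV[R[i]]_(m.+1 + m.+1) -> R[i],
    [/\ [/\ torus_periodic (Vdom b r sigma) f,
            analytic_on (Vdom b r sigma) f & real_on_D b r f],
        sup_norm b r sigma f = (eps j)%:E &
        exists (J : set R) (theta I : R -> 'rV[R]_m.+1),
          maximal_orbit_in_D b r (perturbed (omega alpha) f) J theta I /\
          forall t : R, J t -> `|I t - I 0| = `|t| * v j].
  have [kneq0 Lsmall _] := hkp j; have [Psi0 LM _] := LPsi j.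
  have [i0 qE] := supnormZ_attained (kp j).1 hm.
  have ki0 : (kp j).1 0 i0 != 0 by rewrite -absz_gt0 -qE q0.
  have qr0 : 0 < (q j)%:R :> R by rewrite ltr0n.
  have kabs : `|((kp j).1 0 i0)%:~R| = (q j)%:R :> R.
    by rewrite -intr_norm -abszE /q qE.
  pose k' : 'rV[int]_(1 + m) := row_mx (const_mx (- (kp j).2)) (kp j).1.
  have k'E : k' 0 (rshift 1 i0) = (kp j).1 0 i0 by rewrite row_mxEr.
  pose delta := - (L j / ((kp j).1 0 i0)%:~R).
  apply: (@drifting_perturbation R (1 + m) (omega alpha) b k' (rshift 1 i0)
    delta) => //.
  - by rewrite k'E.
  - by rewrite dot_omega k'E mulNr divfK ?intr_eq0 // subrr.
  (* Size of the linear term: |L j| Psi (A q) <= M, up to the common factor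
     (r + sigma) / (q Psi (A q)). *)
  - rewrite normrN normrM normfV kabs /eps /c /Lambda.
    have QE : Q j = A%:R * (q j)%:R by rewrite -natrM.
    move: (Psi (Q j)) Psi0 LM => P P0 LM; rewrite QE.
    have -> : 2 * (r + sigma) * A%:R * M / (A%:R * (q j)%:R * P) / 2 =
        M / P / (q j)%:R * (r + sigma).
      by field; rewrite !gt_eqF.
    rewrite ler_wpM2r ?(addr_ge0 (ltW r0) (ltW hsigma)) //.
    by rewrite ler_wpM2r ?invr_ge0 ?ler0n // ler_pdivlMr.
  (* Size of the sine: pi |K|_1 <= pi (2 m + 1) q <= A q = Delta (c / eps). *)
  - rewrite /v -mulrA -expRD ger_pMr // -[leRHS]expR0 ler_expR cepsE.
    rewrite Delta_Lambda // addrC subr_le0.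
    have -> : \sum_(l < 1 + m) `|k' 0 l| =
        `|(kp j).2| + \sum_(i < m) `|(kp j).1 0 i|.
      rewrite big_split_ord big_ord1 row_mxEl mxE normrN; congr (_ + _).
      by apply: eq_bigr => l _; rewrite row_mxEr.
    have L1 : `|L j| < 1.
      by apply: lt_le_trans Lsmall _; rewrite invf_le1 ?ler1n.
    have := resonant_vector_size kneq0 halpha L1; rewrite -(ler_int R).
    move: (_ + _) => s hs.
    have {}hs : s%:~R <= (2 * m + 1)%:R * (q j)%:R :> R by rewrite -natrM.
    have h2 : pi * s%:~R <= Q j.
      apply: le_trans (ler_wpM2l (ltW pi0) hs) _.
      by rewrite mulrA /Q natrM ler_wpM2r // ltW.
    have -> : 2 * pi * s%:~R * sigma = 2 * sigma * (pi * s%:~R) by ring.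
    by rewrite ler_wpM2l // mulr_ge0 // ltW.
exists f, eps; split.
  (* eps j <= c |L j| because Lambda (A q) >= Psi (A q) >= 1 / |L j|. *)
  apply: (@squeeze_cvgr _ _ _ _ (fun=> 0) (fun j => c * harmonic j)).
  - near=> j; rewrite (ltW (eps0 j)) /=; apply: le_trans (epsL j) _.
    by rewrite ler_wpM2l ?(ltW c0) //; have [_ /ltW] := hkp j.
  - exact: cvg_cst.
  - rewrite -[X in _ --> X](mulr0 c); apply: cvgM; first exact: cvg_cst.
    exact: cvg_harmonic.
move=> j _; have [hfj hsup [J [theta [I [hmax hI]]]]] := hf j; split=> //.
  by split=> //; rewrite cepsE.
by exists J, theta, I; split=> // t Jt; rewrite hI // mulrA.
Unshelve. all: by end_near.
Qed.
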